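(* For $k\le -1$, the inclusion of $\mathcal{L}_M((k+1)\alpha)$ into $\mathcal{O}(1,\dots,1)(k\alpha)$ induces an isomorphism on global sections, so $C_{L,k}=H^0(W_L,\mathcal{L}_M((k+1)\alpha))$ as subspaces of $\operatorname{Sym}L^*$.
   Context: Let $L$ be a complex vector space of dimension $r$, and let $\ell_1,\dots,\ell_n \in L^*$ be linear forms (possibly zero, possibly proportional) with zero loci $H_1,\dots,H_n$ satisfying $H_1\cap\dots\cap H_n=0$. Set $E=\{1,\dots,n\}$. A flat is a subset $F\subseteq E$ such that if $\bigcap_{i\in F}H_i\subseteq H_j$ then $j\in F$; put $L_F=\bigcap_{i\in F}H_i$ and $\operatorname{rk}(F)=\operatorname{codim}L_F$. A flat is proper if $F\ne E$. The augmented wonderful variety $W_L$ is the smooth projective variety obtained from $\mathbb{P}(L\oplus\mathbb{C})$ by blowing up the strict transforms of the strata $\mathbb{P}(L_F)$ of the hyperplane at infinity $\mathbb{P}L$, for $F$ a proper flat, in increasing order of dimension. It contains $L$ as an open subset, and $W_L\setminus L$ is a simple normal crossings divisor with irreducible components $D_F$, $F$ a proper flat, where $D_F$ is the strict transform of the exceptional divisor over $\mathbb{P}(L_F)$ (the strict transform of $\mathbb{P}L$ if $L_F=L$). $\alpha$ is the pullback to $W_L$ of the hyperplane class of $\mathbb{P}(L\oplus\mathbb{C})$, and $\mathcal{O}(1,\dots,1)$ is the pullback of $\mathcal{O}(1)^{\boxtimes n}$ under the map $W_L\to(\mathbb{P}^1)^n$ extending $(\ell_1,\dots,\ell_n):L\to\mathbb{C}^n$.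 One identifies $\mathcal{O}(\alpha)=\mathcal{O}(\sum_F D_F)$ and $\mathcal{O}(1,\dots,1)=\mathcal{O}(\sum_F (n-|F|)D_F)$ (sums over proper flats), so $\mathcal{O}(1,\dots,1)(k\alpha)=\mathcal{O}(\sum_F(n-|F|+k)D_F)$. The line bundle $\mathcal{L}_M=\omega_{W_L}\otimes\mathcal{O}(1,\dots,1)(\alpha)$, with $\omega_{W_L}$ the canonical bundle, is identified with $\mathcal{O}(\sum_{F}(n-|F|-r+\operatorname{rk}(F))D_F)$; since $r-\operatorname{rk}(F)-1\ge0$ for proper $F$, this makes $\mathcal{L}_M((k+1)\alpha)$ a subsheaf of $\mathcal{O}(1,\dots,1)(k\alpha)$. For a divisor $D$ supported on $W_L\setminus L$, $H^0(W_L,\mathcal{O}(D))$ is the space of rational functions $f$ with $\operatorname{div}(f)+D\ge0$ (together with $0$), viewed by restriction to $L$ as a subspace of $\operatorname{Sym}L^*$. For $v\in L$, $\rho(v)$ is the number of $i$ with $v\notin H_i$. $Z_{L,k}=\operatorname{Sym}L/(v^{\rho(v)+k+1}:v\in L\setminus\{0\})$, with $Z_{L,k}=0$ if some nonzero $v$ has $\rho(v)+k+1\le0$. $\operatorname{Sym}L$ acts on $\operatorname{Sym}L^*$ with $v\in L$ acting by the directional derivative; write $f\odot g$. $C_{L,k}=\{g\in \operatorname{Sym}L^*: f\odot g=0\text{ for all } f\in I\}$, where $I$ is the defining ideal of $Z_{L,k}$. *)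

(* Defs.v *)
From HB Require Import structures.
From mathcomp Require Import all_boot all_order all_algebra.
From mathcomp Require Import reals.
From mathcomp Require Import complex.
From mathcomp Require Import mpoly.

Set Implicit Arguments.
Unset Strict Implicit.
Unset Printing Implicit Defensive.

Import Order.TTheory GRing.Theory Num.Theory.
Local Open Scope ring_scope.

(* An integral separated scheme with function field K is determined by its set
   of local rings, which are subrings of K (Chevalley, Zariski; EGA I, 8).
   So here a subring of K is a predicate on K, a point of a scheme is its local
   ring, and a scheme is a predicate on subrings.  In this language, for points
   A and B of one scheme, A is a specialization of B iff A is contained in B. *)
Section Models.
Variable K : fieldType.
Implicit Types (A B I Y q eta : K -> Prop) (X : (K -> Prop) -> Prop).

Definition contained A B : Prop := forall x, A x -> B x.

Definition same_pred A B : Prop := forall x, A x <-> B x.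

(* 0^-1 = 0, hence the separate case x = 0. *)
Definition nonunits A : K -> Prop := fun x => A x /\ (x = 0 \/ ~ A x^-1).

Definition prime_ideal A q : Prop :=
  [/\ contained q A,
      [/\ q 0, forall x y, q x -> q y -> q (x - y)
         & forall x y, A x -> q y -> q (x * y)],
      ~ q 1
    & forall x y, A x -> A y -> q (x * y) -> q x \/ q y].

Definition localization A q : K -> Prop :=
  fun x => exists b s, [/\ A b, A s, ~ q s & x = b / s].

(* The affine blow-up algebra A[I/a]. *)
Inductive blowup_algebra A I (a : K) : K -> Prop :=
| blowup_base x : A x -> blowup_algebra A I a x
| blowup_frac x : I x -> blowup_algebra A I a (x / a)
| blowup_sub x y : blowup_algebra A I a x -> blowup_algebra A I a y ->
    blowup_algebra A I a (x - y)
| blowup_mul x y : blowup_algebra A I a x -> blowup_algebra A I a y ->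
    blowup_algebra A I a (x * y).

(* B is a point, lying over the closed point of Spec A, of the blow-up of
   Spec A along the ideal I of the local ring A. *)
Definition blowup_over A I B : Prop :=
  exists a q,
    [/\ I a, a != 0, prime_ideal (blowup_algebra A I a) q,
        forall x, A x -> (q x <-> nonunits A x)
      & same_pred B (localization (blowup_algebra A I a) q)].

(* The stalk at A of the ideal sheaf of the integral closed subscheme with
   generic point eta; it is all of A when A is not in that subscheme. *)
Definition ideal_at eta A : K -> Prop :=
  fun x => A x /\ (contained A eta -> nonunits eta x).

(* The blow-up of X along the closure of its point eta. *)
Definition blowup X eta : (K -> Prop) -> Prop :=
  fun B => exists2 A, X A & blowup_over A (ideal_at eta A) B.

Definition ord_with Y (t x : K) (m : int) : Prop :=
  exists u, [/\ u != 0, Y u, Y u^-1 & x = u * t ^ m].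

Definition uniformizer Y (t : K) : Prop :=
  [/\ Y t, ~ Y t^-1 & forall x, x != 0 -> exists m, ord_with Y t x m].

(* On a smooth variety the prime divisors are exactly the points whose local
   ring is a discrete valuation ring. *)
Definition is_dvr Y : Prop := exists t, uniformizer Y t.

(* ord Y x m says that x is nonzero of valuation m. *)
Definition ord Y (x : K) (m : int) : Prop :=
  exists2 t, uniformizer Y t & ord_with Y t x m.

End Models.

(* A basis e of L, with dual basis of coordinates x_0, ..., x_(r-1), identifies
   Sym L^* with C[x_0, ..., x_(r-1)] and Sym L with C[d_0, ..., d_(r-1)], where
   d_i = 'X_i is the i-th vector of e, acting as the derivative along e_i. *)
Section AugmentedWonderful.
Variables (R : realType) (L : vectType R[i]) (r n : nat).
Variables (e : r.-tuple L) (l : 'I_n -> 'Hom(L, (R[i])^o)).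
Local Notation C := R[i].
Local Notation SymLdual := {mpoly C[r]}.
Local Notation SymL := {mpoly C[r]}.
Local Notation K := {fraction {mpoly C[r]}}.
Implicit Types (F : {set 'I_n}) (v : L) (k : int).

Definition H (i : 'I_n) : {vspace L} := lker (l i).

Definition LF F : {vspace L} := (\bigcap_(i in F) H i)%VS.

Definition flat F : bool := [forall j, (LF F <= H j)%VS ==> (j \in F)].

Definition proper_flat F : bool := flat F && (F != [set: 'I_n]).

Definition rk F : nat := (\dim {:L} - \dim (LF F))%N.

(* P(L + C) is Proj of C[z_0, z_1, ..., z_r], with z_0 the coordinate of the
   summand C and z_(j+1) = x_j; the hyperplane at infinity is z_0 = 0, and L is
   embedded as z_0 = 1, so that K is the function field. *)
Definition dehomogenize (p : {mpoly C[r.+1]}) : SymLdual :=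
  p \mPo [tuple if unlift ord0 i is Some j then 'X_j else 1 | i < r.+1].

Definition homogeneous_prime (P : {mpoly C[r.+1]} -> Prop) : Prop :=
  [/\ [/\ P 0, forall p q, P p -> P q -> P (p + q)
         & forall p q, P q -> P (p * q)],
      ~ P 1,
      forall p q, P (p * q) -> P p \/ P q
    & forall p d, P p -> P (pihomog mdeg d p)].

Definition proj_local_ring (P : {mpoly C[r.+1]} -> Prop) : K -> Prop :=
  fun f => exists d p q,
    [/\ p \is d.-homog for mdeg, q \is d.-homog for mdeg, ~ P q
      & f = tofrac (dehomogenize p) / tofrac (dehomogenize q)].

(* The last condition excludes the primes containing the irrelevant ideal. *)
Definition projective_completion (A : K -> Prop) : Prop :=
  exists P, [/\ homogeneous_prime P, exists i, ~ P 'X_i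
              & same_pred A (proj_local_ring P)].

Definition at_infinity v : 'I_r.+1 -> C :=
  fun i => if unlift ord0 i is Some j then coord e j v else 0.

(* The local ring of P(L + C) at the generic point of P(L_F). *)
Definition stratum F : K -> Prop :=
  proj_local_ring (fun p => forall v, v \in LF F -> p.@[at_infinity v] = 0).

(* A strict transform has the same generic point as the original subvariety, so
   the successive centers are the closures of the points stratum F.  Blowing up
   P(L) itself, if L_F = L, comes last and changes nothing. *)
Definition blowup_order : seq {set 'I_n} :=
  sort (fun F G => (\dim (LF F) <= \dim (LF G))%N)
       (enum [set F | proper_flat F]).

Definition wonderful : (K -> Prop) -> Prop :=
  foldl (fun X F => blowup X (stratum F)) projective_completion blowup_order.

(* Y is (the local ring at the generic point of) D_F: the prime divisor of W_L
   that lies over the generic point of P(L_F) in the blow-up of P(L_F).  If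
   L_F = L, this is P(L). *)
Definition boundary_divisor F (Y : K -> Prop) : Prop :=
  [/\ wonderful Y, is_dvr Y
    & blowup_over (stratum F) (nonunits (stratum F)) Y].

(* D stands for the sum of the D F * D_F over the proper flats F; the values at
   other F are irrelevant. *)
Definition boundary_div := {ffun {set 'I_n} -> int}.

(* H^0(W_L, O(D)) as a subspace of Sym L^*.  The prime divisors of W_L are the
   D_F and those meeting L; D has coefficient 0 along the latter, so div(g) + D
   is effective on L iff g is regular on L, i.e. lies in Sym L^*. *)
Definition global_section (D : boundary_div) (g : SymLdual) : Prop :=
  forall F Y m, proper_flat F -> boundary_divisor F Y ->
    ord Y (tofrac g) m -> 0 <= m + D F.

Definition div_alpha : boundary_div := [ffun _ => 1].

Definition div_O1 : boundary_div := [ffun F : {set 'I_n} => n%:Z - #|F|%:Z].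

(* The divisor of the rational form dx_0 /\ ... /\ dx_(r-1): a pole of order
   r + 1 along the hyperplane at infinity, and discrepancy rk F of the blow-up
   of P(L_F), which has codimension rk F + 1. *)
Definition div_canonical : boundary_div :=
  [ffun F => (rk F)%:Z - (\dim {:L})%:Z - 1].

Definition div_LM : boundary_div := div_canonical + div_O1 + div_alpha.

Definition rho v : nat := #|[set i | v \notin H i]|.

Definition sym_vector v : SymL := \sum_(i < r) coord e i v *: 'X_i.

(* A power with exponent <= 0 makes the ideal the whole ring; otherwise all the
   exponents are positive and absz does not change them. *)
Definition Z_ideal k (f : SymL) : Prop :=
  (exists2 v, v != 0 & (rho v)%:Z + k + 1 <= 0) \/
  (exists (m : nat) (h : 'I_m -> SymL) (v : 'I_m -> L),
     (forall i, v i != 0) /\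
     f = \sum_(i < m) h i * sym_vector (v i) ^+ absz ((rho (v i))%:Z + k + 1)).

Definition diff_act (f : SymL) (g : SymLdual) : SymLdual :=
  \sum_(m <- msupp f) f@_m *: g^`M[m].

Definition C_space k (g : SymLdual) : Prop :=
  forall f, Z_ideal k f -> diff_act f g = 0.

End AugmentedWonderful.

(* Main.v *)
(* The local ring of D_F is the valuation ring of minus the degree along L_F: each
   equation of P(L_F) gets weight 1 on the blow-up, and the other centers miss the
   generic point. So a polynomial g is a section of O(sum c_F D_F) iff its degree
   along L_F is at most c_F for every proper flat F, whereas C_{L,k} consists of
   the g whose degree along every v <> 0 is at most rho v + k. The generic v in L_F
   has rho v = n - |F|, so C_{L,k} is H^0 of O(1,...,1)(k alpha). For k <= -1 the
   degree along L_F is smaller by a further dim L_F - 1: this is proved for the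
   component of g of top degree along L_F, by deletion and restriction of the forms
   that do not vanish on L_F. *)
Require Import Defs.
From HB Require Import structures.
From mathcomp Require Import all_boot all_order all_algebra.
From mathcomp Require Import reals.
From mathcomp Require Import complex.
From mathcomp Require Import mpoly.
From mathcomp Require Import ssrcomplements generic_quotient boolp.
From mathcomp Require Import zify ring.

Set Implicit Arguments.
Unset Strict Implicit.
Unset Printing Implicit Defensive.

Import Order.TTheory GRing.Theory Num.Theory.
Local Open Scope ring_scope.

(** Degrees are read off substitutions. For a projection [T] onto V, [phi e T] turns p into p (x - T
    x + t T x), and its size in t is the degree along V plus one; [psi e v] does the same with p (x
    + t v). As [T] is idempotent, [phi] grades the polynomial ring, so the top component along V is
    again a polynomial, and it inherits the bounds along the lines of V. The gain dim V - 1 is a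
    matter of counting. Restricting to the kernel of a form costs one dimension and at least one
    form; dividing by the form costs one degree and exactly one form. The bound is stable under
    both, down to a line, where the degree along V is bounded by that along v. The assumption
    [k <= -1] guarantees that a form is available: without one, a nonzero polynomial would have
    degree at most k < 0. On the geometric side, sections are tested on every Y with
    [boundary_divisor]. Hence the valuation ring has to be exhibited in the iterated blow-up, and
    every such Y has to give the same orders. *)

(** * Polynomials determined by generators and by values *)

Section Generators.
Variables (r : nat) (A : comNzRingType).

Lemma mpoly_gen_ind (P : {mpoly A[r]} -> Prop) :
    (forall c, P c%:MP) -> (forall i, P 'X_i) ->
    (forall p q, P p -> P q -> P (p + q)) ->
    (forall p q, P p -> P q -> P (p * q)) ->
  forall p, P p.
Proof.
move=> PC PX PD PM; elim/mpolyind=> [|c m p _ _ Pp]; first exact: (PC 0).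
apply: (PD) => //; rewrite -mul_mpolyC; apply: (PM) => //.
rewrite mpolyXE_id; apply: (big_ind P); [exact: (PC 1) | exact: (PM) |].
by move=> i _; elim: (m i) => [|j IHj]; [exact: (PC 1) | rewrite exprS; exact: (PM)].
Qed.

Lemma eq_rmorph_mpoly (S : nzRingType) (f g : {rmorphism {mpoly A[r]} -> S}) :
  (forall c, f c%:MP = g c%:MP) -> (forall i, f 'X_i = g 'X_i) -> f =1 g.
Proof.
move=> eqC eqX; elim/mpoly_gen_ind => // p q; first by rewrite !rmorphD => -> ->.
by rewrite !rmorphM => -> ->.
Qed.

Lemma rmorph_mpoly_id (f : {rmorphism {mpoly A[r]} -> {mpoly A[r]}}) p :
  (forall c, f c%:MP = c%:MP) -> (forall i, f 'X_i = 'X_i) -> f p = p.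
Proof. by move=> fC fX; rewrite (eq_rmorph_mpoly (g := idfun) fC fX). Qed.

Lemma subst_subproof (S : comNzRingType) (f : {rmorphism A -> S}) (h : 'I_r -> S) :
  {g : {rmorphism {mpoly A[r]} -> S} |
    (forall c, g c%:MP = f c) /\ (forall i, g 'X_i = h i)}.
Proof.
exists (mmap f h); split=> [c|i] /=; first exact: mmapC.
by rewrite mmapX mmap1U.
Qed.

(* Through the opaque subproof: unfolding mmap makes conversion explode. *)
Definition subst S f h := sval (@subst_subproof S f h).

Lemma substC S f h c : @subst S f h c%:MP = f c.
Proof. exact: (svalP (subst_subproof f h)).1. Qed.

Lemma substX S f h i : @subst S f h 'X_i = h i.
Proof. exact: (svalP (subst_subproof f h)).2. Qed.

End Generators.

Lemma horner_line (A : comNzRingType) (a b z : A) :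
  (a%:P + b%:P * 'X).[z] = a + b * z.
Proof. by rewrite !hornerE. Qed.

Lemma size_line (A : nzRingType) (a b : A) :
  b != 0 -> size (a%:P + b%:P * 'X) = 2%N.
Proof.
by move=> b0; rewrite addrC size_MXaddC polyC_eq0 (negbTE b0) size_polyC b0.
Qed.

Lemma map_line (A B : nzRingType) (g : {rmorphism A -> B}) a b :
  map_poly g (a%:P + b%:P * 'X) = (g a)%:P + (g b)%:P * 'X.
Proof. by rewrite rmorphD rmorphM /= !map_polyC map_polyX. Qed.

Lemma map_polyCXn (A B : nzRingType) (g : {rmorphism A -> B}) a n :
  map_poly g (a%:P * 'X^n) = (g a)%:P * 'X^n.
Proof. by rewrite rmorphM rmorphXn /= map_polyC map_polyX. Qed.

Section Evaluation.
Variables (F : numFieldType) (r : nat).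
Local Notation subC := (subst (r := r) (@mpolyC r F)).
Local Notation subX := (subst (r := r) (@polyC {mpoly F[r]} \o @mpolyC r F)).

(** In characteristic 0 the images of 0, 1, ..., [size q] - 1 are distinct, and they are too many to
    be all roots. *)
Lemma poly_horner_neq0 (A : idomainType) (f : {rmorphism F -> A})
    (q : {poly A}) : q != 0 -> exists c, q.[f c] != 0.
Proof.
move=> q0; pose s := [seq f k%:R | k <- iota 0 (size q)].
have us : uniq s.
  rewrite map_inj_uniq ?iota_uniq // => i j /fmorph_inj /eqP.
  by rewrite eqr_nat => /eqP.
case: (boolP (all (root q) s)) => [rs|/allPn[_ /mapP[k _ ->]]].
  by have := max_poly_roots q0 rs us; rewrite size_map size_iota ltnn.
by rewrite rootE => qk; exists k%:R.
Qed.

Lemma subCC h c : subC h c%:MP = c%:MP. Proof. exact: substC. Qed.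
Lemma subXC h c : subX h c%:MP = c%:MP%:P. Proof. exact: substC. Qed.

(* The variables are specialized one at a time: a nonzero polynomial in 'X_i has
   only finitely many roots among the constants. *)
Lemma mpoly_eval_neq0 (p : {mpoly F[r]}) : p != 0 -> exists a, p.@[a] != 0.
Proof.
move=> p0; pose h (s : seq 'I_r) (a : 'I_r -> F) i : {mpoly F[r]} :=
  if i \in s then (a i)%:MP else 'X_i.
suff [a ha] : exists a, subC (h (enum 'I_r) a) p != 0.
  exists a; apply: contra_neq ha => pa.
  transitivity (p.@[a])%:MP_[r]; last by rewrite pa.
  apply: (eq_rmorph_mpoly (f := subC (h (enum 'I_r) a))
    (g := @mpolyC r F \o meval a)) => [c|i] /=.
    by rewrite subCC mevalC.
  by rewrite substX mevalXU /h mem_enum.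
elim: (enum 'I_r) => [|i s [a ha]].
  exists (fun=> 0); suff -> : subC (h [::] (fun=> 0)) p = p by [].
  by apply: rmorph_mpoly_id => [c|i]; [rewrite subCC | rewrite substX].
pose k j : {poly {mpoly F[r]}} := if j == i then 'X else ('X_j)%:P.
have kE (b : {mpoly F[r]}) q :
    (subX k q).[b] = subC (fun j => if j == i then b else 'X_j) q.
  apply: (eq_rmorph_mpoly (f := horner_eval b \o subX k) (g := subC _)) => [c|j] /=.
    by rewrite horner_evalE subXC hornerC subCC.
  by rewrite horner_evalE !substX /k; case: eqP => _; rewrite hornerE.
have q0 : subX k (subC (h s a) p) != 0.
  apply: contra_neq ha => q0.
  transitivity ((subX k (subC (h s a) p)).['X_i]); last by rewrite q0 horner0.
  rewrite kE [RHS]rmorph_mpoly_id // => [c|j]; first exact: subCC.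
  by rewrite substX; case: eqP => [->|].
have [c] := poly_horner_neq0 (@mpolyC r F) q0.
rewrite kE => hc; exists (fun j => if j == i then if i \in s then a i else c else a j).
apply: contra_neq hc => <-.
apply: (eq_rmorph_mpoly (f := subC _ \o subC _) (g := subC _)) => [d|j] /=.
  by rewrite !subCC.
rewrite [subC (h s a) _]substX [RHS]substX /h inE; case: eqP => [->|ji] /=.
  by case: ifP => _; [rewrite subCC | rewrite substX eqxx].
by case: ifP => _; [rewrite subCC | rewrite substX; case: eqP].
Qed.

End Evaluation.

(** * Substitutions along a projection *)

Section Substitutions.
Variables (F : numFieldType) (L : vectType F) (r : nat) (e : r.-tuple L).
Hypothesis he : basis_of {:L} e.

Local Notation C := {mpoly F[r]}.

(** A bare function is accepted so that composites such as [coord e i \o T] need no packaging. Only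
    the values on the basis are read, so the result represents [f] when [f] is linear. *)
Definition lin (f : L -> F) : C := \sum_(j < r) f e`_j *: 'X_j.

Lemma id_sub_lfunE (T : 'End(L)) v : (\1 - T)%VF v = v - T v.
Proof. by rewrite add_lfunE opp_lfunE id_lfunE. Qed.

Lemma coord_basisE (i j : 'I_r) : coord e i e`_j = (i == j)%:R.
Proof. by rewrite coord_free 1?eq_sym //; exact: basis_free he. Qed.

Lemma basis_expand v : v = \sum_(i < r) coord e i v *: e`_i.
Proof. exact: (coord_basis he (memvf v)). Qed.

Lemma scalar_expand (f : {scalar L}) v : f v = \sum_(j < r) f e`_j * coord e j v.
Proof.
rewrite {1}[v]basis_expand linear_sum; apply: eq_bigr => j _.
by rewrite linearZ mulrC.
Qed.

Lemma eq_lin f g : f =1 g -> lin f = lin g.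
Proof. by move=> fg; apply: eq_bigr => j _; rewrite fg. Qed.

Lemma lin_coord i : lin (coord e i) = 'X_i.
Proof.
rewrite /lin (bigD1 i) //= coord_basisE eqxx scale1r big1 ?addr0 // => j ji.
by rewrite coord_basisE eq_sym (negbTE ji) scale0r.
Qed.

Lemma linD f g : lin (fun v => f v + g v) = lin f + lin g.
Proof. by rewrite /lin -big_split; apply: eq_bigr => j _; rewrite scalerDl. Qed.

Lemma lin_comp (f : {scalar L}) (T : 'End(L)) :
  lin (f \o T) = \sum_(j < r) f e`_j *: lin (coord e j \o T).
Proof.
under [RHS]eq_bigr do rewrite scaler_sumr.
rewrite exchange_big; apply: eq_bigr => j _ /=.
under eq_bigr do rewrite scalerA.
by rewrite -scaler_suml; congr (_ *: _); rewrite [LHS]scalar_expand.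
Qed.

Lemma meval_lin (f : {scalar L}) v : (lin f).@[coord e ^~ v] = f v.
Proof.
rewrite raddf_sum [RHS]scalar_expand; apply: eq_bigr => j _ /=.
by rewrite mevalZ mevalXU.
Qed.

(* As functions on L, pull T p is p (T x), psi v p is p (x + v t), and phi T p is
   p (x - T x + T x t), with t the variable of {poly _}. *)
Fact pull_key : unit. Proof. exact: tt. Qed.
Definition pull_rmorphism (T : 'End(L)) : {rmorphism C -> C} := locked_with pull_key
  (subst (@mpolyC r F) (fun i => lin (coord e i \o T))).
Definition pull (T : 'End(L)) : C -> C := pull_rmorphism T.
HB.instance Definition _ T := GRing.RMorphism.copy (pull T) (pull_rmorphism T).

Fact psi_key : unit. Proof. exact: tt. Qed.
Definition psi_rmorphism (v : L) : {rmorphism C -> {poly C}} := locked_with psi_key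
  (subst (@polyC C \o @mpolyC r F)
    (fun i => ('X_i)%:P + (coord e i v)%:MP%:P * 'X)).
Definition psi (v : L) : C -> {poly C} := psi_rmorphism v.
HB.instance Definition _ v := GRing.RMorphism.copy (psi v) (psi_rmorphism v).

Fact phi_key : unit. Proof. exact: tt. Qed.
Definition phi_rmorphism (T : 'End(L)) : {rmorphism C -> {poly C}} := locked_with phi_key
  (subst (@polyC C \o @mpolyC r F)
    (fun i => (lin (coord e i \o (\1 - T)%VF))%:P
              + (lin (coord e i \o T))%:P * 'X)).
Definition phi (T : 'End(L)) : C -> {poly C} := phi_rmorphism T.
HB.instance Definition _ T := GRing.RMorphism.copy (phi T) (phi_rmorphism T).

Lemma pullC T c : pull T c%:MP = c%:MP.
Proof. by rewrite /pull /pull_rmorphism unlock; exact: substC. Qed.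
Lemma psiC v c : psi v c%:MP = c%:MP%:P.
Proof. by rewrite /psi /psi_rmorphism unlock; exact: substC. Qed.
Lemma phiC T c : phi T c%:MP = c%:MP%:P.
Proof. by rewrite /phi /phi_rmorphism unlock; exact: substC. Qed.

Lemma pullX T i : pull T 'X_i = lin (coord e i \o T).
Proof. by rewrite /pull /pull_rmorphism unlock; exact: substX. Qed.
Lemma psiX v i : psi v 'X_i = ('X_i)%:P + (coord e i v)%:MP%:P * 'X.
Proof. by rewrite /psi /psi_rmorphism unlock; exact: substX. Qed.
Lemma phiX T i : phi T 'X_i =
  (lin (coord e i \o (\1 - T)%VF))%:P + (lin (coord e i \o T))%:P * 'X.
Proof. by rewrite /phi /phi_rmorphism unlock; exact: substX. Qed.

Lemma pull_lin T (f : {scalar L}) : pull T (lin f) = lin (f \o T).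
Proof.
rewrite lin_comp raddf_sum; apply: eq_bigr => j _ /=.
by rewrite -!mul_mpolyC rmorphM /= pullC pullX.
Qed.

Lemma psi_lin v (f : {scalar L}) :
  psi v (lin f) = (lin f)%:P + (f v)%:MP%:P * 'X.
Proof.
rewrite raddf_sum /= [f v]scalar_expand !raddf_sum mulr_suml -big_split.
apply: eq_bigr => j _ /=.
rewrite -!mul_mpolyC rmorphM /= psiC psiX mulrDr mulrA -!polyCM.
by rewrite -mpolyCM mul_mpolyC.
Qed.

Lemma phi_lin T (f : {scalar L}) :
  phi T (lin f) = (lin (f \o (\1 - T)%VF))%:P + (lin (f \o T))%:P * 'X.
Proof.
rewrite !lin_comp raddf_sum !raddf_sum mulr_suml -big_split /=.
apply: eq_bigr => j _ /=.
rewrite -!mul_mpolyC rmorphM /= phiC phiX mulrDr mulrA -!polyCM.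
by rewrite !mul_mpolyC.
Qed.

Lemma phi_at1 T p : (phi T p).[1] = p.
Proof.
apply: (eq_rmorph_mpoly (f := horner_eval 1 \o phi T) (g := idfun)) => [c|i] /=.
  by rewrite horner_evalE phiC hornerC.
rewrite horner_evalE phiX !hornerE /= -linD -[RHS]lin_coord.
by apply: eq_lin => v /=; rewrite -linearD /= id_sub_lfunE subrK.
Qed.

Lemma phi_eq0 T p : (phi T p == 0) = (p == 0).
Proof.
apply/eqP/eqP => [p0|->]; last exact: rmorph0.
by rewrite -[p](phi_at1 T) p0 horner0.
Qed.

Lemma psi_at0 v p : (psi v p).[0] = p.
Proof.
apply: (eq_rmorph_mpoly (f := horner_eval 0 \o psi v) (g := idfun)) => [c|i] /=.
  by rewrite horner_evalE psiC hornerC.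
by rewrite horner_evalE psiX !hornerE.
Qed.

Lemma psi_eq0 v p : (psi v p == 0) = (p == 0).
Proof.
apply/eqP/eqP => [p0|->]; last exact: rmorph0.
by rewrite -[p](psi_at0 v) p0 horner0.
Qed.

(** An idempotent [T] splits the coordinates into those of its kernel, fixed by the substitution,
    and those of its image, scaled by t. So the coefficient of t^i is homogeneous of degree i along
    the image. *)
Lemma phi_coef (T : 'End(L)) p i : (forall v, T (T v) = T v) ->
  phi T (phi T p)`_i = ((phi T p)`_i)%:P * 'X^i.
Proof.
move=> TT; elim/mpoly_gen_ind: p i => [c|j|p q IHp IHq|p q IHp IHq] i.
- by rewrite phiC coefC; case: eqP => [->|_]; rewrite ?phiC ?mulr1 // rmorph0 mul0r.
- rewrite phiX coefD coefC coefCM coefX; case: i => [|[|i]] /=.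
  + rewrite mulr0 addr0 phi_lin mulr1.
    rewrite [X in _ + X%:P * _](_ : _ = 0) ?mul0r ?addr0.
      congr (_%:P); apply: eq_lin => v /=.
      by rewrite !id_sub_lfunE [T (_ - _)]linearB /= TT subrr subr0.
    rewrite /lin big1 // => k _ /=.
    by rewrite !id_sub_lfunE TT subrr linear0 scale0r.
  + rewrite add0r mulr1 phi_lin expr1.
    rewrite [X in X%:P + _](_ : _ = 0) ?add0r.
      by congr (_%:P * _); apply: eq_lin => v /=; rewrite TT.
    rewrite /lin big1 // => k _ /=.
    by rewrite !id_sub_lfunE [T (_ - _)]linearB /= TT subrr linear0 scale0r.
  + by rewrite mulr0 addr0 rmorph0 mul0r.
- by rewrite rmorphD coefD rmorphD /= IHp IHq polyCD mulrDl.
- rewrite rmorphM coefM raddf_sum rmorph_sum mulr_suml.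
  apply: eq_bigr => [[j /= ji]] _.
  rewrite rmorphM /= IHp IHq mulrACA -polyCM -exprD.
  by rewrite subnKC.
Qed.

(* Both sides are p (x - T x + (T x + v s) t), with s the inner variable. *)
Lemma psi_phi (T : 'End(L)) v p (g : {rmorphism C -> {poly {poly C}}}) :
    (forall q, g q = map_poly polyC (phi T q)) -> T v = v ->
  map_poly (psi v) (phi T p) = (map_poly g (psi v p)).[('X)%:P * 'X].
Proof.
move=> gE Tv.
have gC c : g c%:MP = c%:MP%:P%:P by rewrite gE phiC; exact: map_polyC.
have gX i : g 'X_i = (lin (coord e i \o (\1 - T)%VF))%:P%:P
              + (lin (coord e i \o T))%:P%:P * 'X.
  by rewrite gE phiX (map_line polyC).
apply: (eq_rmorph_mpoly (f := map_poly (psi v) \o phi T)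
  (g := horner_eval (('X)%:P * 'X) \o map_poly g \o psi v)) => [c|i] /=.
  have -> : map_poly (psi v) (phi T c%:MP) = c%:MP%:P%:P.
    by rewrite phiC (map_polyC (psi v)) /= psiC.
  by rewrite  psiC (map_polyC g) /= horner_evalE hornerC gC.
have -> : map_poly (psi v) (phi T 'X_i) =
    (lin (coord e i \o (\1 - T)%VF))%:P%:P
    + ((lin (coord e i \o T))%:P + (coord e i v)%:MP%:P * 'X)%:P * 'X.
  rewrite phiX (map_line (psi v)) /= !psi_lin /=.
  by rewrite id_sub_lfunE Tv subrr linear0 mpolyC0 polyC0 mul0r addr0.
rewrite psiX (map_line g) horner_evalE horner_line gX gC polyCD polyCM.
by rewrite mulrDl addrA; congr (_ + _); rewrite mulrA.
Qed.

(** In [psi_phi] the inner variable s only occurs in the product s t. So s^j comes with at least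
    t^j, and j is also at most the degree of p along v. This lets a component along the image of [T]
    inherit the bounds of p along v. *)
Lemma size_psi_coef_phi (T : 'End(L)) v p (i : nat) : T v = v ->
  (size (psi v (phi T p)`_i)%R <= minn (size (psi v p)) i.+1)%N.
Proof.
move=> Tv; rewrite -coef_map (psi_phi p (g := map_poly polyC \o phi T)) //.
rewrite horner_coef coef_sum.
apply: leq_trans (size_sum _ _ _) _; apply/bigmax_leqP => [[j /= jn]] _.
rewrite coef_map /= exprMn -rmorphXn /= mulrA coefMXn.
case: ltnP => [_|ji]; first by rewrite size_poly0.
rewrite coefMC coef_map /= (leq_trans (size_polyMleq _ _)) //.
rewrite size_polyXn addnS /= (leq_trans (leq_add (size_polyC_leq1 _) (leqnn _))) //.
rewrite leq_min ltnS ji andbT (leq_trans jn) //.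
by rewrite (leq_trans (size_poly _ _)).
Qed.

Lemma phi_sum T p : p = \sum_(i < size (phi T p)) (phi T p)`_i.
Proof.
rewrite -[LHS](phi_at1 T) horner_coef; apply: eq_bigr => i _.
by rewrite expr1n mulr1.
Qed.

Lemma size_psi_le_phi (T : 'End(L)) v p : T v = v -> (size (psi v p) <= size (phi T p))%N.
Proof.
move=> Tv.
have -> : psi v p = \sum_(i < size (phi T p)) psi v (phi T p)`_i.
  exact: etrans (f_equal (psi v) (phi_sum T p)) (raddf_sum _ _ _ _).
apply: leq_trans (size_sum _ _ _) _; apply/bigmax_leqP => [[j /= jn]] _.
rewrite (leq_trans (size_psi_coef_phi _ _ Tv)) //.
by rewrite geq_min jn orbT.
Qed.

Lemma phi_pull (P T T' : 'End(L)) q : (forall x, P (T' x) = T (P x)) ->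
  phi T' (pull P q) = map_poly (pull P) (phi T q).
Proof.
move=> PT; apply: (eq_rmorph_mpoly (f := phi T' \o pull P)
  (g := map_poly (pull P) \o phi T)) => [c|j] /=.
  by rewrite pullC (phiC T') (phiC T) (map_polyC (pull P)) /= pullC.
rewrite pullX phi_lin phiX (map_line (pull P)) /= !pull_lin.
congr (_%:P + _%:P * _); apply: eq_lin => x /=; last by rewrite PT.
by rewrite !id_sub_lfunE [P (_ - _)]linearB /= PT.
Qed.

Lemma phi_pull_homog (P T T' : 'End(L)) G N : (forall x, P (T' x) = T (P x)) ->
  phi T G = G%:P * 'X^N -> phi T' (pull P G) = (pull P G)%:P * 'X^N.
Proof.
move=> PT GN; have := map_polyCXn (pull P) G N; rewrite -GN -(phi_pull _ PT).
by apply.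
Qed.

Lemma psi_pull (P : 'End(L)) u q :
  psi u (pull P q) = map_poly (pull P) (psi (P u) q).
Proof.
apply: (eq_rmorph_mpoly (f := psi u \o pull P)
  (g := map_poly (pull P) \o psi (P u))) => [c|j] /=.
  by rewrite pullC (psiC u) (psiC (P u)) (map_polyC (pull P)) /= pullC.
by rewrite pullX psi_lin psiX (map_line (pull P)) /= pullX pullC.
Qed.

Lemma size_psi_pull (P : 'End(L)) u q : (size (psi u (pull P q)) <= size (psi (P u) q))%N.
Proof. by rewrite psi_pull size_poly. Qed.

End Substitutions.

(** * The degree bound *)

Section SkewProjection.
Variables (F : fieldType) (L : lmodType F) (f : {scalar L}) (v0 : L).

(** When [f v0] = 1 this is the projection onto the kernel of [f] along [v0]. *)
Definition skew (x : L) : L := x - f x *: v0.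

Fact skew_linear : linear skew.
Proof.
move=> a x y; rewrite /skew linearP /= scalerDl scalerBr scalerA.
by rewrite opprD addrACA.
Qed.
HB.instance Definition _ := GRing.isLinear.Build F L L _ skew skew_linear.
End SkewProjection.

Section Functional.
Variables (F : fieldType) (L : vectType F) (f : 'Hom(L, F^o)).

(** A linear map into [F^o] repackaged as a scalar form, the type that the lemmas on [lin]
    expect. *)
Definition functional : L -> F := f.

Fact functional_scalar : scalar functional.
Proof. by move=> a x y; rewrite /functional linearP. Qed.
HB.instance Definition _ :=
  GRing.isLinear.Build F L F *%R functional functional_scalar.
End Functional.

Section DegreeBound.
Variables (F : numFieldType) (L : vectType F) (r n : nat) (e : r.-tuple L).
Hypothesis he : basis_of {:L} e.
Variable (l : 'I_n -> 'Hom(L, F^o)).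
Local Notation C := {mpoly F[r]}.

(** Writing T x = c(x) v, the argument x - T x + t T x is (1 - T) x + c(x) t v. So [phi e T] arises
    from [psi e v] by pulling the coefficients back along 1 - T and replacing the variable by c t;
    no power of t exceeds the degree along v. *)
Lemma size_phi_vline (T : 'End(L)) v G N : v != 0 ->
  (forall x, T x \in <[v]>%VS) -> G != 0 -> phi e T G = G%:P * 'X^N ->
  (N < size (psi e v G))%N.
Proof.
move=> v0 TV G0 GN; have [c cE] : exists c : {scalar L}, forall x, T x = c x *: v.
  exists (coord [tuple v] ord0 \o T) => x.
  have Tx : T x \in <<[tuple v]>>%VS by rewrite span_seq1.
  by rewrite {1}(coord_span Tx) big_ord1.
have [g gE] : exists g : {rmorphism C -> {poly C}},
    forall q, g q = (pull e (\1 - T)%VF q)%:P.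
  by exists (polyC \o pull e (\1 - T)%VF).
have phiE p : phi e T p = (map_poly g (psi e v p)).[(lin e c)%:P * 'X].
  pose h : {rmorphism C -> {poly C}} :=
    horner_eval ((lin e c)%:P * 'X) \o map_poly g \o psi e v.
  suff : phi e T =1 h by apply.
  apply: eq_rmorph_mpoly => [d|i]; rewrite /h /=.
    by rewrite phiC psiC (map_polyC g) /= horner_evalE hornerC gE pullC.
  rewrite phiX psiX (map_line g) horner_evalE horner_line !gE pullC pullX.
  rewrite mulrA -polyCM.
  suff -> : lin e (coord e i \o T) = (coord e i v)%:MP * lin e c by [].
  rewrite mul_mpolyC /lin scaler_sumr; apply: eq_bigr => j _.
  by rewrite scalerA /= cE linearZ /= /GRing.scale /= mulrC.
rewrite ltnNge; apply/negP => sN.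
have : (phi e T G)`_N = G by rewrite GN coefCM coefXn eqxx mulr1.
rewrite phiE horner_coef coef_sum big1 => [G0'|j _]; first by rewrite -G0' eqxx in G0.
have jN : (j < N)%N.
  by apply: leq_trans (ltn_ord j) (leq_trans (size_poly _ _) sN).
rewrite coef_map /= gE exprMn -rmorphXn /= mulrA -polyCM coefCM coefXn.
by rewrite gtn_eqF // mulr0.
Qed.

(** The points x and x - f(x) v0 agree modulo f, hence so do the values of p. When the pullback is
    0, this makes f a factor of p. *)
Lemma pull_skew_divides (f : {scalar L}) v0 p :
  exists q, p - pull e (linfun (skew f v0)) p = lin e f * q.
Proof.
elim/mpoly_gen_ind: p => [c|i|p q [p' Ep] [q' Eq]|p q [p' Ep] [q' Eq]].
- by exists 0; rewrite pullC subrr mulr0.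
- exists (coord e i v0)%:MP; rewrite pullX -[X in X - _](lin_coord he) mulrC.
  rewrite mul_mpolyC /lin scaler_sumr -sumrB; apply: eq_bigr => j _.
  rewrite -scalerBl scalerA /= lfunE /= linearB linearZ /= opprB addrC subrK.
  by rewrite mulrC.
- by exists (p' + q'); rewrite mulrDr -Ep -Eq rmorphD opprD addrACA.
exists (p' * q + pull e (linfun (skew f v0)) p * q').
rewrite mulrDr mulrA -Ep mulrCA -Eq mulrBl mulrBr rmorphM addrA subrK.
by [].
Qed.

Lemma card_setD1_hit (S : {set 'I_n}) i (P : pred 'I_n) : i \in S -> P i ->
  #|[set j in S | P j]| = #|[set j in S :\ i | P j]|.+1.
Proof.
move=> iS Pi; rewrite (cardsD1 i) inE iS Pi add1n; congr _.+1.
by apply: eq_card => j; rewrite !inE andbA.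
Qed.

Lemma card_setD1_miss (S : {set 'I_n}) i (P : pred 'I_n) : ~~ P i ->
  #|[set j in S | P j]| = #|[set j in S :\ i | P j]|.
Proof.
move=> Pi; apply: eq_card => j; rewrite !inE.
by case: eqP => [->|//]; rewrite (negbTE Pi) andbF.
Qed.

(* Let f = l i on V, with i in S. If G restricts to 0 on ker f then f divides G,
   and G / f satisfies the hypotheses for S minus i; otherwise the restriction
   satisfies them for V :&: ker f and S minus i. *)
Lemma homogeneous_degree_bound (k : int) (S : {set 'I_n}) (V : {vspace L})
    (T : 'End(L)) (N : nat) (G : C) :
    k <= -1 -> (forall x, T x \in V) -> (forall x, x \in V -> T x = x) ->
    (0 < \dim V)%N -> G != 0 -> phi e T G = G%:P * 'X^N ->
    (forall v, v \in V -> v != 0 ->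
       (size (psi e v G))%:Z <= #|[set i in S | l i v != 0]|%:Z + k + 1) ->
  N%:Z <= #|[set i in S | ~~ (V <= lker (l i))%VS]|%:Z + k + 1 - (\dim V)%:Z.
Proof.
move=> hk; have [m] := ubnP #|S|; elim: m S V T N G => // m IHm S V T N G.
rewrite ltnS => leSm TV Tid dimV G0 GN hV.
pose v := vpick V.
have vV : v \in V by exact: memv_pick.
have v0 : v != 0 by rewrite /v vpick0 -dimv_eq0 -lt0n.
have [dimV1|dimV2] := leqP (\dim V) 1.
  have VE : V = <[v]>%VS.
    by apply/eqP; rewrite eq_sym eqEdim dim_vline v0 dimV1 -memvE vV.
  have {}dimV1 : \dim V = 1%N by apply/eqP; rewrite eqn_leq dimV1 dimV.
  have TV' x : T x \in <[v]>%VS by rewrite -VE.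
  have ltN := size_phi_vline v0 TV' G0 GN.
  have := hV _ vV v0; rewrite dimV1.
  have -> : [set i in S | l i v != 0] = [set i in S | ~~ (V <= lker (l i))%VS].
    by apply/setP => i; rewrite !inE VE -memvE memv_ker.
  by lia.
(* Here [k <= -1] enters: if every form of S vanishes on V, the hypothesis at v reads size <= k + 1
   <= 0, against G != 0. *)
have [SV0|[i iSV]] := set_0Vmem [set i in S | ~~ (V <= lker (l i))%VS].
  have := hV _ vV v0.
  have -> : [set i in S | l i v != 0] = set0.
    apply/setP => i; rewrite !inE; have := in_set0 i; rewrite -SV0 !inE.
    case: (i \in S) => //= /negbT /negPn /subvP /(_ _ vV).
    by rewrite memv_ker => /eqP ->; rewrite eqxx.
  have : (0 < size (psi e v G))%N by rewrite size_poly_gt0 psi_eq0.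
  by rewrite cards0; lia.
move: iSV; rewrite inE => /andP[iS Vi].
have [w wV wi] : exists2 w, w \in V & l i w = 1.
  have /subvPn [w wV] := Vi; rewrite memv_ker => wi.
  exists ((l i w)^-1 *: w); first exact: memvZ.
  by rewrite linearZ /= /GRing.scale /= mulVf.
(* Composing with [T] does not change the form on V, but kills the kernel of [T]. So [lin e f] is
   homogeneous of degree 1 along V, and dividing by it preserves homogeneity. *)
pose f : {scalar L} := functional (l i) \o T.
pose p : 'End(L) := linfun (skew f w).
have pE x : p x = x - l i (T x) *: w by rewrite lfunE.
pose H := (V :&: lker (l i))%VS.
have dimH : (\dim V <= (\dim H).+1)%N.
  rewrite -(limg_ker_dim (l i) V) -addn1 leq_add2l.
  by rewrite (leq_trans (dimvS (subvf _))) // dimvf.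
have Si : (#|S :\ i| < m)%N.
  by move: leSm; rewrite (cardsD1 i) iS.
have cS := card_setD1_hit (P := fun j => ~~ (V <= lker (l j))%VS) iS Vi.
have [pG0|pG0] := eqVneq (pull e p G) 0.
  have [Q GQ] := pull_skew_divides f w G.
  rewrite -/p pG0 subr0 in GQ.
  have f0 : lin e f != 0 by apply: contra_neq G0 => f0; rewrite GQ f0 mul0r.
  have Q0 : Q != 0 by apply: contra_neq G0 => Q0; rewrite GQ Q0 mulr0.
  have phif : phi e T (lin e f) = (lin e f)%:P * 'X.
    rewrite (phi_lin he) [X in X%:P + _](_ : _ = 0).
      rewrite add0r; congr (_%:P * _); apply: eq_lin => x /=.
      by rewrite (Tid (T x)).
    rewrite /lin big1 // => j _ /=.
    by rewrite id_sub_lfunE linearB /= (Tid (T _)) // subrr linear0 scale0r.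
  have : (lin e f)%:P * ('X * phi e T Q) = (lin e f)%:P * (Q%:P * 'X^N).
    by rewrite !mulrA -phif -rmorphM /= -GQ GN {1}GQ polyCM.
  move/(mulfI _); rewrite polyC_eq0 => /(_ f0).
  case: N GN => [|N] GN.
    move/(congr1 (fun q : {poly C} => q`_0)).
    by rewrite /= coefXM coefCM coefXn eqxx mulr1 /= => Q0'; rewrite -Q0' eqxx in Q0.
  rewrite exprS mulrCA => /(mulfI _); rewrite polyX_eq0 => /(_ isT) phiQ.
  have := IHm _ _ _ _ _ Si TV Tid dimV Q0 phiQ.
  have hQ u : u \in V -> u != 0 -> (size (psi e u Q))%:Z <=
      #|[set j in S :\ i | l j u != 0]|%:Z + k + 1.
    move=> uV u0; have := hV _ uV u0; rewrite {1}GQ rmorphM /=.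
    rewrite size_mul ?psi_eq0 // (psi_lin he) /= (Tid _ uV) -[functional _ u]/(l i u).
    have [liu|liu] := eqVneq (l i u) 0.
      rewrite liu mpolyC0 polyC0 mul0r addr0 size_polyC f0.
      by rewrite (card_setD1_miss _ (i := i)) ?liu ?eqxx.
    rewrite (card_setD1_hit (i := i)) //.
    rewrite size_line ?mpolyC_eq0 // !addSn add0n /=.
    by move: (size _) #|_| => a b; clear; lia.
  by move=> /(_ hQ); rewrite cS; move: #|_| (\dim V) => a b; clear; lia.
(* The projection onto H. It satisfies p TH = T p, so the restriction of G is still homogeneous of
   degree N along H. *)
pose TH : 'End(L) := (p \o T)%VF.
have THE x : TH x = T x - l i (T x) *: w by rewrite comp_lfunE pE (Tid (T x)).
have THH x : TH x \in H.
  rewrite memv_cap memv_ker THE memvB ?memvZ //=.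
  by rewrite linearB linearZ /= wi /GRing.scale /= mulr1 subrr.
have pH x : x \in H -> p x = x.
  rewrite memv_cap memv_ker => /andP[xV /eqP xi].
  by rewrite pE (Tid _ xV) xi scale0r subr0.
have THid x : x \in H -> TH x = x.
  by move=> xH; rewrite comp_lfunE (Tid x) ?pH //; move: xH; rewrite memv_cap => /andP[].
have pTH x : p (TH x) = T (p x).
  by rewrite pH // THE pE linearB /= [T (_ *: w)]linearZ /= (Tid w).
have dimH0 : (0 < \dim H)%N by exact: leq_trans dimV2 dimH.
have phipG : phi e TH (pull e p G) = (pull e p G)%:P * 'X^N.
  exact: (phi_pull_homog he pTH GN).
have := IHm _ _ _ _ _ Si THH THid dimH0 pG0 phipG.
have hH u : u \in H -> u != 0 -> (size (psi e u (pull e p G)))%:Z <=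
    #|[set j in S :\ i | l j u != 0]|%:Z + k + 1.
  move=> uH u0; have := uH; rewrite memv_cap memv_ker => /andP[uV liu].
  have := hV _ uV u0; rewrite (card_setD1_miss _ (i := i)) ?liu //.
  have := size_psi_pull he p u G; rewrite pH //.
  by move: (size _) (size _) #|_| => a b c; clear; lia.
move=> /(_ hH); rewrite cS.
(* The loss of at most one dimension is paid for by the form i, which vanishes on H; further forms
   may vanish on H, and this only improves the bound. *)
have : (#|[set j in S :\ i | ~~ (H <= lker (l j))%VS]| <=
        #|[set j in S :\ i | ~~ (V <= lker (l j))%VS]|)%N.
  apply/subset_leq_card/subsetP => j; rewrite !inE => /andP[->] /=.
  by apply: contraNN; apply: subv_trans; exact: capvSl.
by move: #|_| #|_| (\dim V) (\dim H) dimH => a b c d; clear; lia.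
Qed.

End DegreeBound.

Section Directional.
Variables (F : numFieldType) (L : vectType F) (r n : nat) (e : r.-tuple L).
Hypothesis he : basis_of {:L} e.
Local Notation C := {mpoly F[r]}.

(** Apply the homogeneous case to the leading coefficient of [phi e T g]. The constant [k + 2] is
    [k + 1] plus one, as a size exceeds the degree by one. *)
Lemma degree_bound (l : 'I_n -> 'Hom(L, F^o)) (k : int) (V : {vspace L})
    (T : 'End(L)) (g : C) :
    k <= -1 -> (forall x, T x \in V) -> (forall x, x \in V -> T x = x) ->
    (0 < \dim V)%N -> g != 0 ->
    (forall v, v \in V -> v != 0 ->
       (size (psi e v g))%:Z <= #|[set i | l i v != 0]|%:Z + k + 1) ->
  (size (phi e T g))%:Z
  <= #|[set i | ~~ (V <= lker (l i))%VS]|%:Z + k + 2 - (\dim V)%:Z.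
Proof.
move=> hk TV Tid dimV g0 hg; set N := (size (phi e T g)).-1.
have sN : (0 < size (phi e T g))%N by rewrite size_poly_gt0 phi_eq0.
have G0 : (phi e T g)`_N != 0 by rewrite -lead_coefE lead_coef_eq0 phi_eq0.
have GN := phi_coef he g N (fun v => Tid _ (TV v)).
have hG v : v \in V -> v != 0 -> (size (psi e v (phi e T g)`_N))%:Z <=
    #|[set i in [set: 'I_n] | l i v != 0]|%:Z + k + 1.
  move=> vV v0; have := hg v vV v0.
  have := size_psi_coef_phi he g N (Tid _ vV); rewrite leq_min => /andP[+ _].
  rewrite (_ : [set i in [set: 'I_n] | _] = [set i | l i v != 0]); last first.
    by apply/setP => i; rewrite !inE.
  by move: (size _) (size _) #|_| => a b c; clear; lia.
have := homogeneous_degree_bound he hk TV Tid dimV G0 GN hG.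
rewrite (_ : [set i in [set: 'I_n] | _] = [set i | ~~ (V <= lker (l i))%VS]).
  by rewrite /N; move: (size _) sN #|_| (\dim V) => a + b c; clear; lia.
by apply/setP => i; rewrite !inE.
Qed.

(** * Directional derivatives and the inverse system [C_space] *)

Definition dirder (v : L) (p : C) : C := \sum_(i < r) coord e i v *: p^`M(i).

Lemma dirder_mul v p q : dirder v (p * q) = dirder v p * q + p * dirder v q.
Proof.
rewrite /dirder mulr_suml mulr_sumr -big_split; apply: eq_bigr => i _ /=.
by rewrite mderivM scalerDr scalerAl scalerAr.
Qed.

Lemma deriv_psi v p : (psi e v p)^`() = psi e v (dirder v p).
Proof.
elim/mpoly_gen_ind: p => [c|i|p q IHp IHq|p q IHp IHq].
- rewrite psiC derivC /dirder big1 ?rmorph0 // => i _.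
  by rewrite mderivC scaler0.
- rewrite psiX derivD derivC derivM derivC derivX mul0r mulr1 !add0r.
  rewrite /dirder (bigD1 i) //= mderivX mnm1E eqxx big1 => [|j ji].
    have -> : (U_(i) - U_(i) = 0 :> 'X_{1..r})%MM.
      by apply/mnmP => j; rewrite mnmBE subnn mnm0E.
    by rewrite addr0 scale1r mpolyX0 -mul_mpolyC mulr1 psiC.
  by rewrite mderivX mnm1E eq_sym (negbTE ji) scale0r scaler0.
- rewrite rmorphD derivD /= IHp IHq -rmorphD; congr (psi e v _).
  rewrite /dirder -big_split; apply: eq_bigr => i _ /=.
  by rewrite mderivD scalerDr.
- by rewrite rmorphM derivM /= IHp IHq dirder_mul rmorphD !rmorphM.
Qed.

Lemma derivn_psi v p N : (psi e v p)^`(N) = psi e v (iter N (dirder v) p).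
Proof. by elim: N => [|N IHN]; rewrite ?derivn0 // derivnS IHN deriv_psi. Qed.

(** The falling factorials that appear as factors are invertible in characteristic 0. *)
Lemma derivn_eq0 (p : {poly C}) N : (p^`(N) == 0) = (size p <= N)%N.
Proof.
apply/eqP/idP => [pN|/derivn_poly0//]; apply/leq_sizeP => j Nj.
have := congr1 (fun q : {poly C} => q`_(j - N)) pN.
rewrite coef_derivn subnKC // coef0 => /eqP.
rewrite -[_ *+ _](scaler_nat (R := F)) scaler_eq0 pnatr_eq0 -leqn0 leqNgt.
by rewrite ffact_gt0 Nj => /eqP.
Qed.

(** This turns annihilation by the N-th power of v into a degree bound along v: differentiating p (x
    + t v) in t is deriving p along v. *)
Lemma size_psi_le v p N :
  (size (psi e v p) <= N)%N = (iter N (dirder v) p == 0).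
Proof. by rewrite -derivn_eq0 derivn_psi psi_eq0. Qed.

End Directional.

Section DifferentialAction.
Variables (R : realType) (r : nat).
Local Notation P := {mpoly R[i][r]}.
Implicit Types (f g h : P).

Lemma diff_actwE d f g : (msize f <= d)%N ->
  diff_act f g = \sum_(m : 'X_{1..r < d}) f@_m *: g^`M[m].
Proof.
move=> fd; set I : subFinType _ := 'X_{1..r < d}.
rewrite /diff_act (big_mksub I) ?msupp_uniq //=; first last.
  by move=> x /msize_mdeg_lt /leq_trans; apply.
by rewrite big_rmcond //= => j /memN_msupp_eq0 ->; rewrite scale0r.
Qed.

Lemma diff_actDl f1 f2 g : diff_act (f1 + f2) g = diff_act f1 g + diff_act f2 g.
Proof.
pose d := maxn (msize (f1 + f2)) (maxn (msize f1) (msize f2)).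
rewrite !(@diff_actwE d) ?leq_max ?leqnn ?orbT // -big_split.
by apply: eq_bigr => m _; rewrite mcoeffD scalerDl.
Qed.

Lemma diff_actZl c f g : diff_act (c *: f) g = c *: diff_act f g.
Proof.
pose d := maxn (msize (c *: f)) (msize f).
rewrite !(@diff_actwE d) ?leq_max ?leqnn ?orbT // scaler_sumr.
by apply: eq_bigr => m _; rewrite mcoeffZ scalerA.
Qed.

Lemma diff_act0l g : diff_act 0 g = 0.
Proof. by rewrite /diff_act msupp0 big_nil. Qed.

Lemma diff_act0r f : diff_act f 0 = 0.
Proof. by rewrite /diff_act big1 // => m _; rewrite linear0 scaler0. Qed.

Lemma diff_actDr f g1 g2 : diff_act f (g1 + g2) = diff_act f g1 + diff_act f g2.
Proof.
rewrite /diff_act -big_split; apply: eq_bigr => m _ /=.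
by rewrite mderivmD scalerDr.
Qed.

Lemma diff_actZr c f g : diff_act f (c *: g) = c *: diff_act f g.
Proof.
rewrite /diff_act scaler_sumr; apply: eq_bigr => m _.
by rewrite mderivmZ !scalerA mulrC.
Qed.

Lemma diff_actX m g : diff_act 'X_[m] g = g^`M[m].
Proof. by rewrite /diff_act msuppX big_seq1 mcoeffX eqxx scale1r. Qed.

Lemma diff_act_suml (I : Type) (s : seq I) (Q : pred I) (f : I -> P) g :
  diff_act (\sum_(i <- s | Q i) f i) g = \sum_(i <- s | Q i) diff_act (f i) g.
Proof.
by apply: (big_morph (fun f => diff_act f g)) => [a b|];
  [exact: diff_actDl | exact: diff_act0l].
Qed.

Lemma diff_act_mul f h g : diff_act (f * h) g = diff_act f (diff_act h g).
Proof.
elim/mpolyind: f => [|c m f _ _ IHf]; first by rewrite mul0r !diff_act0l.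
rewrite mulrDl !diff_actDl IHf -scalerAl !diff_actZl.
suff -> : diff_act ('X_[m] * h) g = diff_act 'X_[m] (diff_act h g) by [].
elim/mpolyind: h {IHf} => [|c' m' h _ _ IHh].
  by rewrite mulr0 !diff_act0l diff_act0r.
rewrite mulrDr !diff_actDl diff_actDr IHh -scalerAr !diff_actZl diff_actZr.
by rewrite -mpolyXD !diff_actX addmC mderivmDm.
Qed.

End DifferentialAction.

Section CSpace.
Variables (R : realType) (L : vectType R[i]) (r n : nat) (e : r.-tuple L).
Variable (l : 'I_n -> 'Hom(L, (R[i])^o)).

Lemma diff_act_sym_vector v g : diff_act (sym_vector e v) g = dirder e v g.
Proof.
rewrite /sym_vector diff_act_suml; apply: eq_bigr => i _.
by rewrite diff_actZl diff_actX mderivmU1m.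
Qed.

Lemma diff_act_sym_vectorX v N g :
  diff_act (sym_vector e v ^+ N) g = iter N (dirder e v) g.
Proof.
elim: N => [|N IHN]; last by rewrite exprS diff_act_mul IHN diff_act_sym_vector.
by rewrite expr0 -mpolyX0 diff_actX mderivm0m.
Qed.

(** Being killed by an ideal is tested on its generators, the powers of vectors. If some exponent is
    nonpositive, the ideal contains 1, while on the right a positive size would be bounded by that
    exponent; for g != 0 both sides fail. *)
Lemma C_spaceP k (g : {mpoly R[i][r]}) : g != 0 ->
  C_space e l k g <->
  (forall v : L, v != 0 -> (size (psi e v g))%:Z <= (rho l v)%:Z + k + 1).
Proof.
move=> g0; split=> [Cg v v0|hg f].
  have [kv|kv] := lerP ((rho l v)%:Z + k + 1) 0.
    have /Cg : Z_ideal e l k 1 by left; exists v.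
    by rewrite -mpolyX0 diff_actX mderivm0m => g00; rewrite g00 eqxx in g0.
  rewrite -(gez0_abs (ltW kv)) lez_nat size_psi_le -diff_act_sym_vectorX.
  apply/eqP/Cg; right; exists 1%N, (fun=> 1), (fun=> v).
  by split=> //; rewrite big_ord1 mul1r.
have pos v : v != 0 -> 0 < (rho l v)%:Z + k + 1.
  move=> v0; apply: lt_le_trans (hg v v0).
  by rewrite ltz_nat size_poly_gt0 psi_eq0.
case=> [[v /pos vpos]|[m [h [v [v0 ->]]]]]; first by rewrite leNgt vpos.
rewrite diff_act_suml big1 // => i _.
rewrite diff_act_mul diff_act_sym_vectorX.
suff /eqP -> : iter (absz ((rho l (v i))%:Z + k + 1)) (dirder e (v i)) g == 0.
  exact: diff_act0r.
by rewrite -size_psi_le -lez_nat gez0_abs ?hg // ltW ?pos.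
Qed.

End CSpace.

(** * Degree valuations *)

Section DegreeInduction.
Variables (r : nat) (A : comNzRingType) (Q : nat -> {mpoly A[r]} -> Prop).
Hypothesis Q0 : forall d, Q d 0.
Hypothesis QC : forall c, Q 0%N c%:MP.
Hypothesis QX : forall i, Q 1%N 'X_i.
Hypothesis QD : forall d p q, Q d p -> Q d q -> Q d (p + q).
Hypothesis QM : forall d d' p q, Q d p -> Q d' q -> Q (d + d') (p * q).

Lemma monomial_ind m : Q (mdeg m) 'X_[m].
Proof.
have QE d p : Q d p -> forall j, Q (j * d) (p ^+ j).
  move=> Qp; elim=> [|j IHj]; first exact: (QC 1).
  by rewrite exprS mulSn; apply: QM.
rewrite mpolyXE_id mdegE.
apply: (big_ind2 Q) => [|d p d' p' |i _]; [exact: (QC 1) | exact: QM |].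
by rewrite -{1}[m i]muln1; apply: QE.
Qed.

Lemma homog_ind d p : p \is d.-homog for mdeg -> Q d p.
Proof.
move=> /dhomogP pd; rewrite [p]mpolyE big_seq; apply: (big_ind (Q d)) => //.
  by move=> a b; apply: QD.
by move=> m /pd <-; rewrite -mul_mpolyC; apply: (QM (QC _) (monomial_ind m)).
Qed.

(** Monotonicity of [Q] in d replaces homogeneity: monomials of lower degree are raised to level d.
    As [msize] is the degree plus one, [d.+1] means degree at most d. *)
Lemma degree_ind d p : (forall d p, Q d p -> Q d.+1 p) ->
  (msize p <= d.+1)%N -> Q d p.
Proof.
move=> QS pd; rewrite [p]mpolyE big_seq; apply: (big_ind (Q d)) => //.
  by move=> a b; apply: QD.
move=> m mp; rewrite -mul_mpolyC.
have : (mdeg m <= d)%N by rewrite -ltnS (leq_trans (msize_mdeg_lt mp)).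
move=> /subnKC <-; elim: (d - mdeg m)%N => [|j IHj]; last by rewrite addnS; apply: QS.
by rewrite addn0; apply: (QM (QC _) (monomial_ind m)).
Qed.

End DegreeInduction.

Lemma msizeD_leq r (A : nzRingType) (p q : {mpoly A[r]}) d :
  (msize p <= d)%N -> (msize q <= d)%N -> (msize (p + q) <= d)%N.
Proof.
by move=> pd qd; apply: leq_trans (mmeasureD_le _ _ _) _; rewrite geq_max pd.
Qed.

Lemma msizeM_leqS r (A : idomainType) (p q : {mpoly A[r]}) d d' :
  (msize p <= d.+1)%N -> (msize q <= d'.+1)%N -> (msize (p * q) <= (d + d').+1)%N.
Proof.
have [->|p0] := eqVneq p 0; first by rewrite mul0r mmeasure0.
have [->|q0] := eqVneq q 0; first by rewrite mulr0 mmeasure0.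
by rewrite msizeM //; move: (msize p) (msize q) => a b; clear; lia.
Qed.

Section FractionRepr.
Import FracField.
Local Open Scope quotient_scope.
Variable D : idomainType.
Local Notation "x %:F" := (@tofrac D x).

Lemma frac_reprE (x : {fraction D}) : x = (repr x).1%:F / (repr x).2%:F.
Proof.
rewrite -{1}[x]reprK; case: (repr x) => [[p q] /= q0]; unlock tofrac.
rewrite -[X in _ = _ * X]pi_inv -[RHS]pi_mul; congr (\pi _).
rewrite /mulf /invf /= !numden_Ratio ?oner_neq0 // mulr1 mul1r.
by rewrite -[LHS]Ratio_numden.
Qed.

Lemma frac_repr (x : {fraction D}) : exists p q, q != 0 /\ x = p%:F / q%:F.
Proof. by exists (repr x).1, (repr x).2; rewrite -frac_reprE denom_ratioP. Qed.

End FractionRepr.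

Section DegreeValuation.
Variables (D : idomainType) (dg : D -> nat).
Hypothesis dg_gt0 : forall p, (0 < dg p)%N = (p != 0).
Hypothesis dgM : forall p q : D, p != 0 -> q != 0 -> dg (p * q) = (dg p + dg q).-1.
Hypothesis dgB : forall p q, (dg (p - q) <= maxn (dg p) (dg q))%N.
Local Notation K := {fraction D}.
Local Notation "x %:F" := (@tofrac D x).
Implicit Types (x y : K) (p q : D) (m : int).

Fact fval_key : unit. Proof. exact: tt. Qed.
(** Minus the degree of a fraction; the shifts by one in the two sizes cancel. The value at 0 is
    meaningless. *)
Definition fval x : int :=
  locked_with fval_key ((dg (repr x).2)%:Z - (dg (repr x).1)%:Z).

Lemma tofrac_neq0 p : p != 0 -> p%:F != 0.
Proof. by rewrite tofrac_eq0. Qed.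

Lemma fval_frac p q : p != 0 -> q != 0 -> fval (p%:F / q%:F) = (dg q)%:Z - (dg p)%:Z.
Proof.
move=> p0 q0; rewrite /fval unlock; set x := p%:F / q%:F.
have d0 : (repr x).2 != 0 by exact: denom_ratioP.
have E : p * (repr x).2 = (repr x).1 * q.
  apply/eqP; rewrite -tofrac_eq !tofracM -eqr_div ?tofrac_neq0 //.
  by rewrite -frac_reprE.
have n0 : (repr x).1 != 0.
  apply: contra_neq p0 => n0; move/eqP: E.
  by rewrite n0 mul0r mulf_eq0 (negbTE d0) orbF => /eqP.
have := dgM p0 d0; rewrite E dgM //.
have := dg_gt0 p; have := dg_gt0 q; have := dg_gt0 (repr x).1.
have := dg_gt0 (repr x).2; rewrite p0 q0 d0 n0.
by move: (dg _) (dg _) (dg _) (dg _) => a b c d; clear; lia.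
Qed.

Lemma frac_repr_neq0 x : x != 0 ->
  exists p q, [/\ p != 0, q != 0 & x = p%:F / q%:F].
Proof.
have [p [q [q0 ->]]] := frac_repr x; rewrite mulf_eq0 negb_or tofrac_eq0.
by move=> /andP[p0 _]; exists p, q.
Qed.

Lemma fval_tofrac p : p != 0 -> fval p%:F = (dg 1)%:Z - (dg p)%:Z.
Proof. by move=> p0; rewrite -fval_frac ?oner_neq0 // tofrac1 divr1. Qed.

Lemma fvalM x y : x != 0 -> y != 0 -> fval (x * y) = fval x + fval y.
Proof.
move=> /frac_repr_neq0[p [q [p0 q0 ->]]] /frac_repr_neq0[p' [q' [p'0 q'0 ->]]].
rewrite mulrACA -invfM -!tofracM !fval_frac ?mulf_neq0 // !dgM //.
have := dg_gt0 p; have := dg_gt0 q; have := dg_gt0 p'; have := dg_gt0 q'.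
rewrite p0 q0 p'0 q'0.
by move: (dg _) (dg _) (dg _) (dg _) => a b c d; clear; lia.
Qed.

Lemma fval1 : fval 1 = 0.
Proof. by rewrite -tofrac1 fval_tofrac ?oner_neq0 // subrr. Qed.

Lemma fvalV x : x != 0 -> fval x^-1 = - fval x.
Proof.
by move=> x0; apply/eqP; rewrite -addr_eq0 addrC -fvalM ?invr_neq0 // divff // fval1.
Qed.

Lemma fvalXn x n : x != 0 -> fval (x ^+ n) = fval x * n%:Z.
Proof.
move=> x0; elim: n => [|n IHn]; first by rewrite expr0 fval1 mulr0.
by rewrite exprS fvalM ?expf_neq0 // IHn -add1n PoszD mulrDr mulr1.
Qed.

Lemma fvalXz x m : x != 0 -> fval (x ^ m) = fval x * m.
Proof.
case: m => n x0; first exact: fvalXn.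
by rewrite NegzE -exprnN fvalV ?expf_neq0 // fvalXn // mulrN.
Qed.

Definition vge m x : bool := (x == 0) || (m <= fval x).

Lemma vge0 m : vge m 0. Proof. by rewrite /vge eqxx. Qed.

Lemma vgeE m x : x != 0 -> vge m x = (m <= fval x).
Proof. by rewrite /vge => /negbTE ->. Qed.

Lemma vge_inv m x : x != 0 -> vge m x^-1 = (m <= - fval x).
Proof. by move=> x0; rewrite vgeE ?invr_neq0 // fvalV. Qed.

Lemma vge_mul m x y : x != 0 -> y != 0 -> vge m (x * y) = (m <= fval x + fval y).
Proof. by move=> x0 y0; rewrite vgeE ?mulf_neq0 // fvalM. Qed.

Lemma vge_div m x y : x != 0 -> y != 0 -> vge m (x / y) = (m <= fval x - fval y).
Proof. by move=> x0 y0; rewrite vge_mul ?invr_neq0 // fvalV. Qed.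

Lemma fval_div x y : x != 0 -> y != 0 -> fval (x / y) = fval x - fval y.
Proof. by move=> x0 y0; rewrite fvalM ?invr_neq0 // fvalV. Qed.

Lemma vge_frac m p q : q != 0 -> p = 0 \/ m <= (dg q)%:Z - (dg p)%:Z ->
  vge m (p%:F / q%:F).
Proof.
move=> q0; have [->|p0] := eqVneq p 0; first by rewrite tofrac0 mul0r vge0.
case=> [pe|le]; first by rewrite pe eqxx in p0.
by rewrite /vge fval_frac // le orbT.
Qed.

Lemma vgeM m m' x y : vge m x -> vge m' y -> vge (m + m') (x * y).
Proof.
have [->|x0] := eqVneq x 0; first by rewrite mul0r !vge0.
have [->|y0] := eqVneq y 0; first by rewrite mulr0 !vge0.
by rewrite !vgeE ?mulf_neq0 // fvalM //; exact: lerD.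
Qed.

Lemma vgeB m x y : vge m x -> vge m y -> vge m (x - y).
Proof.
have [p [q [q0 ->]]] := frac_repr x; have [p' [q' [q'0 ->]]] := frac_repr y.
move=> hx hy.
have E : p%:F / q%:F - p'%:F / q'%:F = (p * q' - p' * q)%:F / (q * q')%:F.
  by rewrite -mulNr addf_div ?tofrac_neq0 // mulNr tofracB !tofracM.
have [E0|E0] := eqVneq (p * q' - p' * q) 0.
  by rewrite E E0 tofrac0 mul0r vge0.
have bound a b s : s != 0 -> b != 0 -> vge m (a%:F / b%:F) ->
    a = 0 \/ m + (dg (a * s))%:Z <= (dg (b * s))%:Z.
  move=> s0 b0; have [->|a0] := eqVneq a 0; first by left.
  have ab0 : a%:F / b%:F != 0 by rewrite mulf_neq0 ?invr_eq0 ?tofrac_eq0.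
  rewrite vgeE // fval_frac // !dgM // => h; right.
  have := dg_gt0 a; have := dg_gt0 s; have := dg_gt0 b; rewrite a0 s0 b0.
  by move: h; move: (dg _) (dg _) (dg _) => i j t; clear; lia.
rewrite E; apply: vge_frac; [exact: mulf_neq0 | right].
have {hx} := bound _ _ _ q'0 q0 hx; have {hy} := bound _ _ _ q0 q'0 hy.
have := dgB (p * q') (p' * q); rewrite [q' * q]mulrC.
have D0 : dg 0 = 0%N by apply/eqP; rewrite -leqn0 leqNgt dg_gt0 eqxx.
move=> h h1 h2.
have {}h1 : (dg (p' * q) = 0)%N \/ m + (dg (p' * q))%:Z <= (dg (q * q'))%:Z.
  by case: h1 => [->|]; [left; rewrite mul0r D0 | right].
have {}h2 : (dg (p * q') = 0)%N \/ m + (dg (p * q'))%:Z <= (dg (q * q'))%:Z.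
  by case: h2 => [->|]; [left; rewrite mul0r D0 | right].
have h3 : (0 < dg (p * q' - p' * q))%N by rewrite dg_gt0.
by move: (dg _) (dg _) (dg _) (dg _) h h1 h2 h3 => a b c d; clear; lia.
Qed.

End DegreeValuation.

(** * Blowing up a linear center *)

Section LocalRing.
Variables (F : numFieldType) (L : vectType F) (r : nat) (e : r.-tuple L).
Hypothesis he : basis_of {:L} e.
Variable T : 'End(L).
Hypothesis TT : forall v, T (T v) = T v.
Local Notation C := {mpoly F[r]}.
Local Notation K := {fraction {mpoly F[r]}}.
Local Notation "x %:F" := (@tofrac {mpoly F[r]} x).
Implicit Types (p q : C) (x : K) (A B : K -> Prop).

Lemma phi_lin_range (f : {scalar L}) :
  phi e T (lin e (f \o T)) = (lin e (f \o T))%:P * 'X.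
Proof.
rewrite (phi_lin he) [X in X%:P + _](_ : _ = 0).
  by rewrite add0r; congr (_%:P * _); apply: eq_lin => x /=; rewrite TT.
rewrite /lin big1 // => j _ /=.
by rewrite id_sub_lfunE linearB /= TT subrr linear0 scale0r.
Qed.

Lemma phi_lin_kernel (f : {scalar L}) :
  phi e T (lin e (f \o (\1 - T)%VF)) = (lin e (f \o (\1 - T)%VF))%:P.
Proof.
rewrite (phi_lin he) [X in _ + X%:P * _](_ : _ = 0).
  rewrite mul0r addr0; congr (_%:P); apply: eq_lin => x /=.
  by rewrite !id_sub_lfunE [T (_ - _)]linearB /= TT subrr subr0.
rewrite /lin big1 // => j _ /=.
by rewrite id_sub_lfunE TT subrr linear0 scale0r.
Qed.

Lemma msize_lin (f : L -> F) : (msize (lin e f) <= 2)%N.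
Proof.
rewrite /lin; apply: leq_trans (mmeasure_sum _ _ _ _) _.
apply/bigmax_leqP => i _; apply: leq_trans (msizeZ_le _ _) _.
by rewrite msizeX mdeg1.
Qed.

Lemma lin_neq0 (f : {scalar L}) v : f v != 0 -> lin e f != 0.
Proof. by apply: contra_neq => f0; rewrite -(meval_lin he) f0 meval0. Qed.

Definition dg p : nat := size (phi e T p).

Lemma dg_gt0 p : (0 < dg p)%N = (p != 0).
Proof. by rewrite size_poly_gt0 (phi_eq0 he). Qed.

Lemma dgM p q : p != 0 -> q != 0 -> dg (p * q) = (dg p + dg q).-1.
Proof. by move=> p0 q0; rewrite /dg rmorphM size_mul ?(phi_eq0 he). Qed.

Lemma dgB p q : (dg (p - q) <= maxn (dg p) (dg q))%N.
Proof.
rewrite /dg rmorphB /=; apply: leq_trans (size_polyD _ _) _.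
by rewrite size_polyN.
Qed.

Lemma dgC c : c != 0 -> dg c%:MP = 1%N.
Proof. by move=> c0; rewrite /dg phiC size_polyC mpolyC_eq0 c0. Qed.

Lemma size_mul_bound (p q : {poly C}) d d' : (size p <= d.+1)%N -> (size q <= d'.+1)%N ->
  (size (p * q)%R <= (d + d').+1)%N.
Proof.
move=> pd qd; apply: leq_trans (size_polyMleq _ _) _.
by move: (size _) (size _) pd qd => a b; clear; lia.
Qed.

Lemma dg_le_msize p : (dg p <= msize p)%N.
Proof.
have [->|p0] := eqVneq p 0; first by rewrite /dg rmorph0 size_poly0.
have : (0 < msize p)%N by rewrite lt0n mmeasure_poly_eq0.
case E : (msize p) => [//|d] _; apply: (degree_ind (Q := fun d p => dg p <= d.+1)%N).
- by move=> n; rewrite /dg rmorph0 size_poly0.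
- by move=> c; rewrite /dg phiC size_polyC_leq1.
- move=> i; rewrite /dg phiX; apply: leq_trans (size_polyD _ _) _.
  rewrite geq_max (leq_trans (size_polyC_leq1 _)) //=.
  apply: leq_trans (size_polyMleq _ _) _; rewrite size_polyX addn2 /=.
  by rewrite ltnS size_polyC_leq1.
- move=> n a b; rewrite /dg rmorphD /= => ha hb.
  by apply: leq_trans (size_polyD _ _) _; rewrite geq_max ha.
- by move=> n n' a b; rewrite /dg rmorphM; exact: size_mul_bound.
- by move=> n a; exact: leqW.
- by rewrite E.
Qed.

Local Notation fval := (@fval _ dg).
Local Notation vge := (@vge _ dg).
Local Notation fvalV := (fvalV dg_gt0 dgM).
Local Notation fval_frac := (fval_frac dg_gt0 dgM).
Local Notation vge_frac := (vge_frac dg_gt0 dgM).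

(* The denominators are the polynomials whose part of top total degree does not
   vanish identically on the image of T. *)
Definition local_ring x : Prop :=
  exists p q, [/\ q != 0, (msize p <= msize q)%N, dg q = msize q & x = p%:F / q%:F].

Lemma local_ringC c : local_ring (c%:MP)%:F.
Proof.
exists c%:MP, 1; split; rewrite ?oner_neq0 //.
- by rewrite mmeasureC mmeasure1; case: eqP.
- by rewrite -mpolyC1 dgC ?oner_neq0 // mmeasureC oner_neq0.
- by rewrite tofrac1 divr1.
Qed.

Lemma msizeM_leq p q p' q' : q != 0 -> q' != 0 ->
  (msize p <= msize q)%N -> (msize p' <= msize q')%N ->
  (msize (p * p') <= msize (q * q'))%N.
Proof.
move=> q0 q'0 pq pq'; have [->|p0] := eqVneq p 0; first by rewrite mul0r mmeasure0.
have [->|p'0] := eqVneq p' 0; first by rewrite mulr0 mmeasure0.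
rewrite !msizeM //; move: (msize p) (msize q) (msize p') (msize q') pq pq'.
by clear; lia.
Qed.

Lemma dgM_msize q q' : q != 0 -> q' != 0 -> dg q = msize q -> dg q' = msize q' ->
  dg (q * q') = msize (q * q').
Proof. by move=> q0 q'0 dq dq'; rewrite dgM // msizeM // dq dq'. Qed.

Lemma local_ringB x x' : local_ring x -> local_ring x' -> local_ring (x - x').
Proof.
move=> [p [q [q0 pq dq ->]]] [p' [q' [q'0 pq' dq' ->]]].
exists (p * q' - p' * q), (q * q'); split; rewrite ?mulf_neq0 //.
- apply: leq_trans (mmeasureD_le _ _ _) _; rewrite mmeasureN geq_max.
  by rewrite msizeM_leq //= mulrC msizeM_leq.
- exact: dgM_msize.
- by rewrite -mulNr addf_div ?tofrac_neq0 // mulNr tofracB !tofracM.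
Qed.

Lemma local_ringM x x' : local_ring x -> local_ring x' -> local_ring (x * x').
Proof.
move=> [p [q [q0 pq dq ->]]] [p' [q' [q'0 pq' dq' ->]]].
exists (p * p'), (q * q'); split; rewrite ?mulf_neq0 //.
- exact: msizeM_leq.
- exact: dgM_msize.
- by rewrite mulrACA -invfM !tofracM.
Qed.

Lemma local_ring1 : local_ring 1.
Proof. by rewrite -tofrac1 -mpolyC1; exact: local_ringC. Qed.

Lemma local_ringX x n : local_ring x -> local_ring (x ^+ n).
Proof.
move=> Ax; elim: n => [|n IHn]; first exact: local_ring1.
by rewrite exprS; exact: local_ringM.
Qed.

Lemma local_ring_vge0 x : local_ring x -> vge 0 x.
Proof.
move=> [p [q [q0 pq dq ->]]]; apply: vge_frac => //; right.
by rewrite subr_ge0 lez_nat dq (leq_trans (dg_le_msize p)).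
Qed.

(** In dg p <= msize p <= msize q = dg q, valuation 0 makes the two ends equal, so p is itself an
    admissible denominator. Hence the maximal ideal is the part of positive valuation. *)
Lemma local_ringV x : local_ring x -> x != 0 -> fval x = 0 -> local_ring x^-1.
Proof.
move=> [p [q [q0 pq dq ->]]]; rewrite mulf_eq0 negb_or tofrac_eq0 => /andP[p0 _].
rewrite fval_frac // => /eqP; rewrite subr_eq0 => /eqP [dpq].
have qp : (msize q <= msize p)%N by rewrite -dq dpq dg_le_msize.
exists q, p; split=> //; last by rewrite invf_div.
by apply/eqP; rewrite eqn_leq dg_le_msize -dpq dq.
Qed.

Lemma nonunits_local_ring x : nonunits local_ring x <-> local_ring x /\ vge 1 x.
Proof.
split=> -[Ax hx]; split=> //.
  have [->|x0] := eqVneq x 0; first exact: vge0.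
  case: hx => [x00|Ax']; first by rewrite x00 eqxx in x0.
  have := local_ring_vge0 Ax; rewrite !vgeE // le_eqVlt => /orP[/eqP vx|].
    by case: Ax'; apply: local_ringV.
  by rewrite -gtz0_ge1.
have [->|x0] := eqVneq x 0; [by left | right=> /local_ring_vge0].
move: hx; rewrite !vgeE ?invr_eq0 // fvalV //.
by move: (fval x) => m; clear; lia.
Qed.

End LocalRing.

(* Stated for an abstract field: the field tactic is very slow on {fraction _}. *)
Lemma mulf_shift (K : fieldType) (a b u v y : K) : a != 0 -> y != 0 ->
  b * (u * v) = b * (1 / (y * a)) * ((y * u) * (a * v)).
Proof. by move=> a0 y0; field; rewrite a0 y0. Qed.

Lemma subf_div (K : fieldType) (a b c d : K) : b != 0 -> d != 0 ->
  a / b - c / d = (a * d - c * b) / (b * d).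
Proof. by move=> b0 d0; rewrite -mulNr addf_div // mulNr. Qed.

Lemma divf_succ (K : fieldType) (a c u : K) : a != 0 -> c / u = c / (a * u) * a.
Proof. by move=> a0; rewrite invfM; move: u^-1 => w; field. Qed.

Lemma divf_square (K : fieldType) (a : K) : a != 0 -> a / a ^+ 2 * a = 1.
Proof. by move=> a0; field. Qed.

Lemma divf_div2 (K : fieldType) (p q u : K) : u != 0 -> p / q = p / u / (q / u).
Proof. by move=> u0; rewrite invf_div; move: q^-1 => w; field. Qed.

Lemma divf_expV (K : fieldType) (p u v : K) : v != 0 -> p / (u * v) / v^-1 = p / u.
Proof. by move=> v0; rewrite invfM invrK mulrA divfK. Qed.

Lemma mulf_cancel (K : fieldType) (a b q u v : K) : a != 0 ->
  b * (u * (v * a)) * (q^-1 / a) = b * (v * (u / q)).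
Proof.
by move=> a0; move: q^-1 => w; field.
Qed.

Section BlowUp.
Variables (F : numFieldType) (L : vectType F) (r : nat) (e : r.-tuple L).
Hypothesis he : basis_of {:L} e.
Variable T : 'End(L).
Hypothesis TT : forall v, T (T v) = T v.
Local Notation C := {mpoly F[r]}.
Local Notation K := {fraction {mpoly F[r]}}.
Local Notation "x %:F" := (@tofrac {mpoly F[r]} x).
Implicit Types (p q : C) (x : K) (A B : K -> Prop).

Local Notation dg := (dg e T).
Local Notation dg_gt0 := (dg_gt0 he T).
Local Notation dgM := (@dgM _ _ _ _ he T).
Local Notation dgB := (dgB e T).
Local Notation AF := (local_ring e T).
Local Notation fval := (@fval _ dg).
Local Notation vge := (@vge _ dg).
Local Notation fvalM := (fvalM dg_gt0 dgM).
Local Notation fvalV := (fvalV dg_gt0 dgM).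
Local Notation fvalXn := (fvalXn dg_gt0 dgM).
Local Notation fvalXz := (fvalXz dg_gt0 dgM).
Local Notation fval_frac := (fval_frac dg_gt0 dgM).
Local Notation vgeM := (vgeM dg_gt0 dgM).
Local Notation vgeB := (vgeB dg_gt0 dgM dgB).
Local Notation vge_inv := (vge_inv dg_gt0 dgM).
Local Notation vge_mul := (vge_mul dg_gt0 dgM).
Local Notation vge_div := (vge_div dg_gt0 dgM).
Local Notation fval_div := (fval_div dg_gt0 dgM).
Local Notation vge_frac := (vge_frac dg_gt0 dgM).

Variables (f : {scalar L}) (v1 : L).
Hypothesis fTv1 : f (T v1) != 0.
(** A linear form whose degree along the image of [T] equals its total degree 1. Its powers are
    admissible denominators, and 1 / y is an element of the local ring of valuation 1. *)
Let y := lin e (f \o T).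

Lemma y_neq0 : y != 0.
Proof. exact: (lin_neq0 he (f := f \o T) fTv1). Qed.

Lemma dg_y : dg y = 2%N.
Proof.
have := phi_lin_range he TT f; rewrite /dg -/y => ->.
by rewrite size_mulX ?polyC_eq0 ?y_neq0 // size_polyC y_neq0.
Qed.

Lemma msize_y : msize y = 2%N.
Proof.
by apply/eqP; rewrite eqn_leq msize_lin -{1}dg_y dg_le_msize.
Qed.

Lemma dg_yX n : dg (y ^+ n) = n.+1.
Proof.
elim: n => [|n IHn]; first by rewrite expr0 -mpolyC1 dgC ?oner_neq0.
by rewrite exprS dgM ?expf_neq0 ?y_neq0 // IHn dg_y.
Qed.

Lemma msize_yX n : msize (y ^+ n) = n.+1.
Proof.
elim: n => [|n IHn]; first by rewrite expr0 mmeasure1.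
by rewrite exprS msizeM ?expf_neq0 ?y_neq0 // IHn msize_y.
Qed.

Lemma tofrac_y_neq0 : y%:F != 0.
Proof. by rewrite tofrac_eq0 y_neq0. Qed.

Lemma fval_y : fval y%:F = -1.
Proof.
rewrite (fval_tofrac dg_gt0 dgM y_neq0) dg_y -mpolyC1 dgC //.
exact: oner_neq0.
Qed.

Lemma tofrac_yV_neq0 : y%:F^-1 != 0.
Proof. exact: (invr_neq0 tofrac_y_neq0). Qed.

Lemma fval_yV : fval y%:F^-1 = 1.
Proof. by rewrite (fvalV tofrac_y_neq0) fval_y. Qed.

Lemma local_ring_divy p d : (msize p <= d.+1)%N -> AF (p%:F / (y ^+ d)%:F).
Proof.
move=> pd; exists p, (y ^+ d); split; rewrite ?expf_neq0 ?y_neq0 //.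
  by rewrite msize_yX.
by rewrite msize_yX dg_yX.
Qed.

Lemma vge_divy p d m : p = 0 \/ m <= d.+1%:Z - (dg p)%:Z -> vge m (p%:F / (y ^+ d)%:F).
Proof. by move=> h; apply: vge_frac; rewrite ?expf_neq0 ?y_neq0 // dg_yX. Qed.

Section Chart.
Variable a : K.
Hypotheses (Ia : nonunits AF a) (a0 : a != 0).
Local Notation B := (blowup_algebra AF (nonunits AF) a).

Lemma chart0 : B 0.
Proof.
by rewrite -(subrr 1); apply: blowup_sub; apply: blowup_base; exact: local_ring1.
Qed.

Lemma chartD x x' : B x -> B x' -> B (x + x').
Proof.
move=> Bx Bx'; rewrite -[x']opprK; apply: blowup_sub => //.
by rewrite -sub0r; apply: blowup_sub => //; exact: chart0.
Qed.

Lemma chart_sum (I : Type) (s : seq I) (P : pred I) (x : I -> K) :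
  (forall i, P i -> B (x i)) -> B (\sum_(i <- s | P i) x i).
Proof.
move=> Bx; apply: (big_ind (fun z : K => B z)) => //; first exact: chart0.
exact: chartD.
Qed.

Lemma chartX x n : B x -> B (x ^+ n).
Proof.
move=> Bx; elim: n => [|n IHn]; first by apply: blowup_base; exact: local_ring1.
by rewrite exprS; exact: blowup_mul.
Qed.

Let aA : AF a := Ia.1.
Let yK0 := tofrac_y_neq0.

(** Such a p is affine linear and constant along the image of [T], so p / y is a local equation of
    the center. *)
Lemma chart_divy p : (msize p <= 2)%N -> (dg p <= 1)%N -> B (p%:F / (y%:F * a)).
Proof.
move=> mp dp; rewrite invfM mulrA; apply: blowup_frac.
apply/(nonunits_local_ring he); split.
  by have := local_ring_divy (d := 1) mp; rewrite expr1.
have := vge_divy (d := 1) (p := p) (m := 1); rewrite expr1; apply; right.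
by move: (dg _) dp => n; clear; lia.
Qed.

(* Substituting a t for t and dividing by (y a)^d brings the coefficients of
   phi p into the chart; it suffices to check this on the variables. *)
Lemma chart_coef p d (i : nat) : (msize p <= d.+1)%N ->
  exists2 b, B b & ((phi e T p)`_i)%:F = b * (y%:F ^+ d * a ^+ (d - i)).
Proof.
(* The vanishing clause guards the truncated subtraction [d - i], which is additive in products only
   while i <= d. *)
move=> pd; pose R d (i : nat) (z : C) := ((d < i)%N -> z = 0) /\
  exists2 b, B b & z%:F = b * (y%:F ^+ d * a ^+ (d - i)).
have R0 n j : R n j 0.
  by split=> //; exists 0; [exact: chart0 | rewrite tofrac0 mul0r].
have RD n j u v : R n j u -> R n j v -> R n j (u + v).
  move=> [u0 [b Bb ub]] [v0 [b' Bb' vb]]; split=> [nj|]; first by rewrite u0 ?v0 ?addr0.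
  by exists (b + b'); [exact: chartD | rewrite tofracD ub vb mulrDl].
have RM n n' j j' u v : R n j u -> R n' j' v -> R (n + n')%N (j + j')%N (u * v).
  move=> [u0 [b Bb ub]] [v0 [b' Bb' vb]].
  have [nj|jn] := ltnP n j; first by rewrite u0 // mul0r; exact: R0.
  have [nj'|jn'] := ltnP n' j'; first by rewrite v0 // mulr0; exact: R0.
  split=> [|]; first by rewrite ltnNge leq_add.
  exists (b * b'); first exact: blowup_mul.
  have -> : (n + n' - (j + j') = (n - j) + (n' - j'))%N.
    by move: jn jn'; clear; lia.
  by rewrite tofracM ub vb !exprD; ring.
have RS n j u : R n j u -> R n.+1 j u.
  move=> [u0 [b Bb ub]]; have [nj|jn] := ltnP n j; first by rewrite u0 //; exact: R0.
  split=> [|]; first by rewrite ltnNge leqW.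
  exists (b * (1%:F / (y%:F * a))).
    apply: blowup_mul => //; apply: chart_divy; first by rewrite mmeasure1.
    by rewrite -mpolyC1 dgC ?oner_neq0.
  by rewrite ub (mulf_shift b _ _ a0 yK0) subSn // tofrac1 -!exprS.
suff : R d i (phi e T p)`_i by case.
apply: (degree_ind (Q := fun d p => forall i, R d i (phi e T p)`_i)) => //.
- by move=> n j; rewrite rmorph0 coef0.
- move=> c [|j]; rewrite phiC coefC /=; last exact: R0.
  split=> //; exists (c%:MP)%:F; first by apply: blowup_base; exact: local_ringC.
  by rewrite !expr0 !mulr1.
- move=> j; rewrite phiX => -[|[|k]]; rewrite coefD coefC coefCM coefX /=.
  + rewrite mulr0 addr0; split=> //.
    exists ((lin e (coord e j \o (\1 - T)%VF))%:F / (y%:F * a)).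
      apply: chart_divy; first exact: msize_lin.
      by rewrite /dg (phi_lin_kernel he TT) size_polyC_leq1.
    have ya0 : y%:F * a != 0 by exact: (mulf_neq0 yK0 a0).
    by rewrite subn0 expr1 expr1 (divfK ya0).
  + rewrite add0r mulr1; split=> //.
    exists ((lin e (coord e j \o T))%:F / (y ^+ 1)%:F).
      by apply: blowup_base; apply: local_ring_divy; exact: msize_lin.
    by rewrite subnn expr0 mulr1 expr1 expr1 (divfK yK0).
  + by rewrite mulr0 add0r; exact: R0.
- by move=> n u v Ru Rv j; rewrite rmorphD coefD; exact: RD.
- move=> n n' u v Ru Rv j; rewrite rmorphM coefM.
  apply: (big_ind (R (n + n')%N j)) => [|x x'|[m mj] _] /=; [exact: R0 | exact: RD |].
  by have := RM _ _ _ _ _ _ (Ru m) (Rv (j - m)%N); rewrite subnKC.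
- by move=> n u Ru j; exact: RS.
Qed.

(** For x = p / q with q of degree d, valuation at least n says that p only has components of degree
    i <= d - n along the image. By [chart_coef] each of them carries a^(d - i), and y^d / q lies in
    the local ring. *)
Lemma chart_div x n : AF x -> vge n%:Z x -> B (x / a ^+ n).
Proof.
have [->|x0] := eqVneq x 0; first by rewrite mul0r => _ _; exact: chart0.
move=> [p [q [q0 pq dq xE]]]; move: x0; rewrite xE mulf_eq0 negb_or tofrac_eq0.
move=> /andP[p0 _]; case Ed : (msize q) => [|d] in pq dq *.
  by move: q0; rewrite -(mmeasure_poly_eq0 mdeg) Ed.
rewrite vgeE ?mulf_neq0 ?invr_eq0 ?tofrac_eq0 // fval_frac // dq => h.
rewrite {1}(phi_sum he T p) rmorph_sum /= -mulrA mulr_suml; apply: chart_sum => i _.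
have [b Bb ->] := chart_coef i pq.
have ni : (n <= d - i)%N.
  by move: h (ltn_ord i); rewrite -/(dg p); move: (dg p) (val i) => s j; clear; lia.
have -> : b * (y%:F ^+ d * a ^+ (d - i)) * (q%:F^-1 / a ^+ n) =
    b * (a ^+ (d - i - n) * ((y ^+ d)%:F / q%:F)).
  by rewrite -{1}(subnK ni) exprD tofracXn (mulf_cancel _ _ _ _ (expf_neq0 n a0)).
apply: blowup_mul => //; apply: blowup_mul.
  by apply: chartX; apply: blowup_base.
apply: blowup_base; exists (y ^+ d), q; split; rewrite ?msize_yX ?Ed //.
Qed.
Lemma chart_repr x : B x ->
  exists n c, [/\ AF c, vge n%:Z c & x = c / a ^+ n].
Proof.
have va : vge 1 a := ((nonunits_local_ring he T a).1 Ia).2.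
have vaX n : vge n%:Z (a ^+ n).
  have an0 : a ^+ n != 0 := expf_neq0 n a0.
  rewrite (vgeE _ _ an0) (fvalXn _ a0) -{1}[n%:Z]mul1r ler_wpM2r //.
  by rewrite -(vgeE dg _ a0).
elim=> {x} [x Ax|x /(nonunits_local_ring he)[Ax vx]|
  x x' _ [n [c [Ac vc ->]]] _ [n' [c' [Ac' vc' ->]]]|
  x x' _ [n [c [Ac vc ->]]] _ [n' [c' [Ac' vc' ->]]]].
- by exists 0%N, x; split; rewrite ?expr0 ?divr1 //; exact: local_ring_vge0.
- by exists 1%N, x; split.
- exists (n + n')%N, (c * a ^+ n' - c' * a ^+ n); split.
  + by apply: local_ringB => //; apply: local_ringM => //; exact: local_ringX.
  + rewrite PoszD; apply: vgeB; first exact: vgeM.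
    by rewrite addrC; exact: vgeM.
  + by rewrite exprD (subf_div _ _ (expf_neq0 n a0) (expf_neq0 n' a0)).
- exists (n + n')%N, (c * c'); split; first exact: local_ringM.
  + by rewrite PoszD; exact: vgeM.
  + by rewrite exprD invfM mulrACA.
Qed.

Hypothesis va : fval a = 1.

Lemma chart_vge0 x : B x -> vge 0 x.
Proof.
elim=> {x} [x /(local_ring_vge0 he)//|x /(nonunits_local_ring he)[_ vx]|
  x x' _ hx _ hx'|x x' _ hx _ hx'].
- rewrite -(subrr 1); apply: vgeM => //.
  by rewrite (vge_inv _ a0) va.
- exact: vgeB.
- by rewrite -(addr0 0); exact: vgeM.
Qed.

(** In a chart where [a] has valuation 1, the exceptional divisor has equation a: one more factor a
    can be divided out of c / a^n. *)
Lemma chart_vge1 x : B x -> vge 1 x -> exists2 z, B z & x = z * a.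
Proof.
have [->|x0] := eqVneq x 0; first by exists 0; [exact: chart0 | rewrite mul0r].
move=> /chart_repr[n [c [Ac _ xE]]] vx.
have an0 : a ^+ n != 0 := expf_neq0 n a0.
have c0 : c != 0 by apply: contra_neq x0 => c0; rewrite xE c0 mul0r.
exists (c / a ^+ n.+1).
  apply: chart_div => //; move: vx.
  rewrite (vgeE _ _ x0) (vgeE _ _ c0) xE (fval_div c0 an0) (fvalXn _ a0) va mul1r.
  by move: (fval c) => m; clear; lia.
by rewrite exprS -(divf_succ _ _ a0).
Qed.
End Chart.

(** The prime q lies over the closed point, so it contains a. If a had valuation at least 2, then 1
    / a = a / a^2 would be in the chart and 1 in q; so a has valuation 1 and generates the elements
    of positive valuation. Those then lie in q, and denominators have valuation 0. *)
Lemma blowup_vge0 Y : blowup_over AF (nonunits AF) Y -> forall x, Y x -> vge 0 x.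
Proof.
move=> [a [q [Ia a0 [qB [q0 qB' qM] q1 _] over YE]]].
have [aA va] := (nonunits_local_ring he T a).1 Ia.
have qa : q a := (over a aA).2 Ia.
have fa : fval a = 1.
  apply/eqP; rewrite eq_le -(vgeE dg _ a0) va andbT leNgt; apply/negP => fa.
  have Ba : blowup_algebra AF (nonunits AF) a (a / a ^+ 2).
    by apply: chart_div => //; rewrite vgeE.
  by apply: q1; rewrite -(divf_square a0); exact: qM.
move=> x /YE[b [s [Bb Bs qs ->]]].
have vs : ~~ vge 1 s.
  by apply/negP => /(chart_vge1 Ia a0 fa Bs)[z Bz sE]; apply: qs; rewrite sE; exact: qM.
have s0 : s != 0 by apply: contraNneq vs => ->; exact: vge0.
rewrite -(addr0 0); apply: vgeM; first exact: (chart_vge0 a0 fa).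
have := chart_vge0 a0 fa Bs; move: vs; rewrite (vge_inv _ s0) !(vgeE _ _ s0).
by move: (fval s) => m; clear; lia.
Qed.

Lemma uniformizer_neq0 Y (t : K) : uniformizer Y t -> t != 0.
Proof. by case=> Yt Yt' _; apply/eqP => t0; apply: Yt'; rewrite t0 invr0 -t0. Qed.

(* Discrete valuation rings are maximal subrings, so Y is the ring of vge 0. *)
Lemma blowup_ord Y x m : blowup_over AF (nonunits AF) Y -> ord Y x m -> m = fval x.
Proof.
move=> /blowup_vge0 Yv [t ut [u [u0 Yu Yu' ->]]].
have t0 := uniformizer_neq0 ut.
have unit0 z : z != 0 -> Y z -> Y z^-1 -> fval z = 0.
  move=> z0 /Yv + /Yv; rewrite (vge_inv _ z0) (vgeE _ _ z0).
  by move: (fval z) => k; clear; lia.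
(* The element 1 / y, of valuation 1, is a unit of Y times a power of t; so the nonnegative integer
   [fval t] divides 1. *)
have t1 : fval t = 1.
  have [Yt _ /(_ _ tofrac_yV_neq0)[k [u' [u'0 Yu1 Yu1' yE]]]] := ut.
  have := fval_yV; rewrite yE (fvalM u'0 (expfz_neq0 _ t0)) (unit0 _ u'0) //.
  rewrite (fvalXz _ t0) add0r; move: (Yv _ Yt); rewrite (vgeE _ _ t0).
  move: (fval t) => w; clear=> w0 wk.
  by have [k0|k0] := lerP k 0; [have : w * k <= 0 | have : w <= w * k]; nia.
by rewrite (fvalM u0 (expfz_neq0 _ t0)) (unit0 _ u0) // (fvalXz _ t0) t1 add0r mul1r.
Qed.

(* The local ring of the blow-up at the generic point of the exceptional divisor. *)
Definition valuation_ring x : Prop := vge 0 x.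

Lemma uniformizer_inv_y : uniformizer valuation_ring y%:F^-1.
Proof.
rewrite /valuation_ring; split=> [||x x0].
- by rewrite (vgeE _ _ tofrac_yV_neq0) fval_yV.
- by rewrite invrK (vgeE _ _ tofrac_y_neq0) fval_y.
have t0 : y%:F^-1 ^ fval x != 0 := expfz_neq0 _ tofrac_yV_neq0.
have tx : fval (y%:F^-1 ^ fval x) = fval x.
  by rewrite (fvalXz _ tofrac_yV_neq0) fval_yV mul1r.
exists (fval x), (x / y%:F^-1 ^ fval x); split.
- exact: (mulf_neq0 x0 (invr_neq0 t0)).
- by rewrite (vge_div _ x0 t0) tx subrr.
- by rewrite invf_div (vge_div _ t0 x0) tx subrr.
- by rewrite (divfK t0).
Qed.

Lemma ord_valuation_ring x : x != 0 -> ord valuation_ring x (fval x).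
Proof.
move=> x0; exists y%:F^-1; first exact: uniformizer_inv_y.
have [_ _ /(_ _ x0)[m xm]] := uniformizer_inv_y.
suff -> : fval x = m by [].
case: xm => u [u0 vu vu' ->].
rewrite (fvalM u0 (expfz_neq0 _ tofrac_yV_neq0)) (fvalXz _ tofrac_yV_neq0) fval_yV.
move: vu vu'; rewrite /valuation_ring (vge_inv _ u0) (vgeE _ _ u0).
by move: (fval u) => w; clear; lia.
Qed.

Lemma vge1_oner : ~~ vge 1 1.
Proof. by rewrite (vgeE _ _ (oner_neq0 _)) (fval1 dg_gt0 dgM). Qed.

Lemma blowup_valuation_ring : blowup_over AF (nonunits AF) valuation_ring.
Proof.
pose a := y%:F^-1; have a0 : a != 0 := tofrac_yV_neq0.
have fa : fval a = 1 := fval_yV.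
have Ia : nonunits AF a.
  apply/(nonunits_local_ring he); split; last by rewrite (vgeE _ _ a0) fa.
  have := local_ring_divy (p := 1) (d := 1); rewrite mmeasure1 tofrac1 mul1r expr1.
  by apply.
have v0 := chart_vge0 a0 fa.
exists a, (fun x => blowup_algebra AF (nonunits AF) a x /\ vge 1 x); split=> //.
- split=> [x []//|||x x' Bx Bx' [_ vxx']].
  + split=> [|x x' [Bx vx] [Bx' vx']|x x' Bx [Bx' vx']].
    * by split; [exact: chart0 | exact: vge0].
    * by split; [exact: blowup_sub | exact: vgeB].
    * by split; [exact: blowup_mul | rewrite -(add0r 1); apply: vgeM => //; exact: v0].
  + by case=> _; apply/negP; exact: vge1_oner.
  + have [->|x0] := eqVneq x 0; first by left; split; [exact: chart0 | exact: vge0].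
    have [->|x'0] := eqVneq x' 0; first by right; split; [exact: chart0 | exact: vge0].
    have [vx|vx] := boolP (vge 1 x); first by left.
    right; split=> //; move: vxx' vx (v0 _ Bx).
    rewrite (vge_mul _ x0 x'0) !(vgeE _ _ x0) (vgeE _ _ x'0).
    by move: (fval x) (fval x') => s t; clear; lia.
- move=> x Ax; split; first by case=> _ vx; apply/(nonunits_local_ring he).
  by case/(nonunits_local_ring he) => _ vx; split=> //; exact: blowup_base.
move=> x; split=> [vx|[b [s [Bb Bs qs ->]]]]; last first.
  have vs : ~~ vge 1 s by apply/negP => vs; apply: qs.
  have s0 : s != 0 by apply: contraNneq vs => ->; exact: vge0.
  rewrite /valuation_ring -(addr0 0); apply: vgeM; first exact: v0.
  have := v0 _ Bs; move: vs; rewrite (vge_inv _ s0) !(vgeE _ _ s0).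
  by move: (fval s) => m; clear; lia.
have [x0|/frac_repr_neq0[p [q [p0 q0 xE]]]] := eqVneq x 0.
  exists 0, 1; split; [exact: chart0 | by apply: blowup_base; exact: local_ring1 | |].
    by case=> _; apply/negP; exact: vge1_oner.
  by rewrite x0 mul0r.
pose d := maxn (msize p) (msize q).
have dgq : (0 < dg q)%N by rewrite dg_gt0.
have pF0 := tofrac_neq0 p0; have qF0 := tofrac_neq0 q0.
have dpq : (dg p <= dg q)%N.
  move: vx; rewrite /valuation_ring xE (vgeE _ _ (mulf_neq0 pF0 (invr_neq0 qF0))).
  by rewrite (fval_frac p0 q0) subr_ge0 lez_nat.
have ye0 n : y ^+ n != 0 := expf_neq0 n y_neq0.
(* Numerator and denominator are both divided by y^(dg q - 1), which gives the denominator valuation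
   0. The quotients lie in the chart of a = 1 / y, since p' / y^d is in the local ring and its
   valuation allows division by the remaining power of a. *)
have Bdiv p' : (msize p' <= d)%N -> (dg p' <= dg q)%N ->
    blowup_algebra AF (nonunits AF) a (p'%:F / (y ^+ (dg q).-1)%:F).
  move=> p'd p'q.
  have dqd : (dg q <= d)%N by rewrite (leq_trans (dg_le_msize _ _ _)) // leq_maxr.
  have -> : p'%:F / (y ^+ (dg q).-1)%:F = (p'%:F / (y ^+ d)%:F) / a ^+ (d - (dg q).-1).
    have dE : (d = (dg q).-1 + (d - (dg q).-1))%N by move: dqd; clear; lia.
    rewrite /a exprVn !tofracXn.
    have -> : y%:F ^+ d = y%:F ^+ (dg q).-1 * y%:F ^+ (d - (dg q).-1).
      by rewrite -exprD -dE.
    by rewrite (divf_expV _ _ (expf_neq0 _ tofrac_y_neq0)).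
  apply: (chart_div Ia a0); first by apply: local_ring_divy; exact: leqW.
  apply: vge_divy; right; move: dqd p'q dgq; clear; lia.
exists (p%:F / (y ^+ (dg q).-1)%:F), (q%:F / (y ^+ (dg q).-1)%:F); split.
- by apply: Bdiv => //; exact: leq_maxl.
- by apply: Bdiv => //; exact: leq_maxr.
- case=> _; rewrite (vgeE _ _ (mulf_neq0 qF0 (invr_neq0 (tofrac_neq0 (ye0 _))))).
  rewrite (fval_frac q0 (ye0 _)) dg_yX.
  by move: (dg q) dgq => j; clear; lia.
- by rewrite xE -(divf_div2 _ _ (tofrac_neq0 (ye0 _))).
Qed.

Lemma nonunits_valuation_ring x : nonunits valuation_ring x <-> vge 1 x.
Proof.
rewrite /nonunits /valuation_ring.
have [->|x0] := eqVneq x 0.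
  by split=> [_|]; [exact: vge0 | split; [exact: vge0 | left]].
rewrite (vge_inv _ x0) !(vgeE _ _ x0); split=> [[vx [x00|nv]]|vx].
- by rewrite x00 eqxx in x0.
- by move: (fval x) vx nv => k; clear; lia.
- by split; [|right]; move: (fval x) vx => k; clear; lia.
Qed.

End BlowUp.

(** * The wonderful variety *)

Section UnaffectedBlowUp.
Variable K : fieldType.
Implicit Types (A eta : K -> Prop) (x y : K).

Lemma same_pred_eq A A' : same_pred A A' -> A = A'.
Proof. by move=> AA'; apply: funext => x; apply: propext; exact: AA'. Qed.

(** Off the center the stalk of the ideal is all of [A]. The chart at a = 1 is then [A] itself, and
    localizing at the nonunits of this local ring gives [A] back. *)
Lemma blowup_unaffected X eta A : X A -> A 1 ->
    (forall x y, A x -> A y -> A (x - y)) -> (forall x y, A x -> A y -> A (x * y)) ->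
    (forall x y, nonunits A x -> nonunits A y -> nonunits A (x - y)) ->
  ~ contained A eta -> blowup X eta A.
Proof.
move=> XA A1 AB AM nB nA; exists A => //.
have idE x : ideal_at eta A x <-> A x by split=> [[]|].
have BE x : blowup_algebra A (ideal_at eta A) 1 x <-> A x.
  split; last exact: blowup_base.
  by elim=> {x} [//|x /idE|x y _ Ax _ Ay|x y _ Ax _ Ay];
    [rewrite divr1 | exact: AB | exact: AM].
have A0 : A 0 by rewrite -(subrr 1); exact: AB.
have unit x : A x -> ~ nonunits A x -> x != 0 /\ A x^-1.
  move=> Ax nx; split; first by apply/eqP => x0; apply: nx; split; [|left].
  by apply: contrapT => Ax'; apply: nx; split; [|right].
exists 1, (nonunits A); split; rewrite ?oner_neq0 //.
  split=> [x [Ax _]||[_ [/eqP|]]|x y /BE Ax /BE Ay]; first exact/BE.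
  - split=> [|//|x y /BE Ax [Ay hy]]; first by split; [|left].
    split; first exact: AM.
    have [->|x0] := eqVneq x 0; first by left; rewrite mul0r.
    case: hy => [->|Ay']; [by left; rewrite mulr0 | right=> Axy].
    by apply: Ay'; rewrite -(mulVKf x0 y^-1) -invfM; exact: AM.
  - by rewrite oner_eq0.
  - by rewrite invr1.
  - move=> [_ hxy]; apply: contrapT.
    move=> /not_orP[/(unit _ Ax)[x0 Ax'] /(unit _ Ay)[y0 Ay']].
    case: hxy => [/eqP|]; first by rewrite mulf_eq0 (negbTE x0) (negbTE y0).
    by apply; rewrite invfM; exact: AM.
move=> x; split=> [Ax|[b [s [/BE Ab /BE As ns ->]]]].
  exists x, 1; split; [exact/BE | exact/BE | | by rewrite divr1].
  by case=> _ [/eqP|]; rewrite ?oner_eq0 // invr1.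
by have [_ As'] := unit _ As ns; exact: AM.
Qed.

End UnaffectedBlowUp.

(** * Local rings of projective space in affine terms *)

Section Homogenization.
Variables (R : realType) (L : vectType R[i]) (r : nat) (e : r.-tuple L).
Hypothesis he : basis_of {:L} e.
Variable V : {vspace L}.
Local Notation F := R[i].
Local Notation T := (projv V).
Local Notation vanishes p := (forall v, v \in V -> p.@[at_infinity e v] = 0).
Implicit Types (p q : {mpoly F[r.+1]}).

Lemma dehomogenizeX0 : dehomogenize ('X_ord0 : {mpoly F[r.+1]}) = 1.
Proof.
rewrite /dehomogenize comp_mpolyXU -tnth_nth tnth_mktuple.
by rewrite unlift_none.
Qed.

Lemma dehomogenizeX i :
  dehomogenize ('X_(lift ord0 i) : {mpoly F[r.+1]}) = 'X_i.
Proof. by rewrite /dehomogenize comp_mpolyXU -tnth_nth tnth_mktuple liftK. Qed.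

Lemma homogenization (p : {mpoly F[r]}) d : (msize p <= d.+1)%N ->
  exists2 q : {mpoly F[r.+1]}, q \is d.-homog for mdeg & dehomogenize q = p.
Proof.
move=> pd; pose Q d (p : {mpoly F[r]}) := exists2 q : {mpoly F[r.+1]},
  q \is d.-homog for mdeg & dehomogenize q = p.
rewrite -/(Q d p); move: pd; apply: degree_ind => {p d}.
- by move=> d; exists 0; [exact: dhomog0 | exact: raddf0].
- move=> c; exists c%:MP; last exact: comp_mpolyC.
  by rewrite -[c%:MP]mulr1 mul_mpolyC; apply: rpredZ; exact: dhomog1.
- move=> i; exists 'X_(lift ord0 i); last exact: dehomogenizeX.
  by rewrite dhomogX; apply/eqP; exact: mdeg1.
- move=> d p q [p' hp' <-] [q' hq' <-]; exists (p' + q'); first exact: rpredD.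
  exact: comp_mpolyD.
- move=> d d' p q [p' hp' <-] [q' hq' <-]; exists (p' * q'); first exact: dhomogM.
  exact: rmorphM.
- move=> d p [p' hp' <-]; exists ('X_ord0 * p').
    rewrite -[d.+1]add1n; apply: dhomogM => //.
    by rewrite dhomogX; apply/eqP; exact: mdeg1.
  by rewrite /dehomogenize rmorphM /= -/(dehomogenize _) dehomogenizeX0 mul1r.
Qed.

Fact infinity_key : unit. Proof. exact: tt. Qed.
Definition infinity_rmorphism : {rmorphism {mpoly F[r.+1]} -> {mpoly F[r]}} :=
  locked_with infinity_key (subst (@mpolyC r F)
    (fun i => if unlift ord0 i is Some j then lin e (coord e j \o T) else 0)).
(* Restriction to the hyperplane at infinity, composed with the projection T. *)
Definition infinity : {mpoly F[r.+1]} -> {mpoly F[r]} := infinity_rmorphism.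
HB.instance Definition _ := GRing.RMorphism.copy infinity infinity_rmorphism.

Lemma infinityC c : infinity c%:MP = c%:MP.
Proof. by rewrite /infinity /infinity_rmorphism unlock; exact: substC. Qed.

Lemma infinityX0 : infinity 'X_ord0 = 0.
Proof.
rewrite /infinity /infinity_rmorphism unlock.
by apply: etrans (substX _ _ _) _; rewrite unlift_none.
Qed.

Lemma infinityX i : infinity 'X_(lift ord0 i) = lin e (coord e i \o T).
Proof.
rewrite /infinity /infinity_rmorphism unlock.
by apply: etrans (substX _ _ _) _; rewrite liftK.
Qed.

Lemma coef_mul_top (A : nzRingType) (f g : {poly A}) d d' :
  (size f <= d.+1)%N -> (size g <= d'.+1)%N -> (f * g)`_(d + d') = f`_d * g`_d'.
Proof.
move=> fd gd; rewrite coefM.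
have dd : (d < (d + d').+1)%N by rewrite ltnS leq_addr.
rewrite (bigD1 (Ordinal dd)) //= addKn big1 ?addr0 // => j jd.
have [dj|jd'] := ltnP d j; first by rewrite nth_default ?mul0r // (leq_trans fd).
rewrite [g`__]nth_default ?mulr0 // (leq_trans gd) //.
have : (j < d)%N by rewrite ltn_neqAle jd' andbT; exact: jd.
by move: (nat_of_ord j) => k; clear; lia.
Qed.

(** Setting z_0 = 1 lowers the degree of every monomial containing z_0, so degree d along V only
    sees the restriction to P(V). A form of degree d is thus nonzero on P(V) iff its
    dehomogenization has degree d along V. *)
Lemma dehomogenize_homog p d : p \is d.-homog for mdeg ->
  (msize (dehomogenize p) <= d.+1)%N /\ (phi e T (dehomogenize p))`_d = infinity p.
Proof.
apply: (homog_ind (Q := fun d p => (msize (dehomogenize p) <= d.+1)%N /\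
  (phi e T (dehomogenize p))`_d = infinity p)) => {p d}.
- move=> d; have -> : dehomogenize (0 : {mpoly F[r.+1]}) = 0 by exact: raddf0.
  by rewrite mmeasure0 !rmorph0 coef0.
- move=> c.
  have -> : dehomogenize (c%:MP : {mpoly F[r.+1]}) = c%:MP by exact: comp_mpolyC.
  split; first by rewrite mmeasureC; case: eqP.
  by rewrite phiC coefC infinityC.
- move=> i; case: (unliftP ord0 i) => [j ->|->].
    rewrite dehomogenizeX infinityX msizeX mdeg1 phiX coefD coefC coefCM coefX.
    by rewrite add0r mulr1.
  by rewrite dehomogenizeX0 infinityX0 mmeasure1 -mpolyC1 phiC coefC.
- move=> d p q [hp tp] [hq tq].
  have -> : dehomogenize (p + q) = dehomogenize p + dehomogenize q by exact: comp_mpolyD.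
  split; first exact: (msizeD_leq hp hq).
  have E := rmorphD (phi e T) (dehomogenize p) (dehomogenize q).
  apply: etrans (congr1 (fun f : {poly {mpoly F[r]}} => f`_d) E) _.
  apply: etrans (coefD _ _ _) _.
  exact: (etrans (f_equal2 +%R tp tq) (esym (rmorphD infinity p q))).
- move=> d d' p q [hp tp] [hq tq].
  have -> : dehomogenize (p * q) = dehomogenize p * dehomogenize q by exact: rmorphM.
  split; first exact: (msizeM_leqS hp hq).
  have E := rmorphM (phi e T) (dehomogenize p) (dehomogenize q).
  apply: etrans (congr1 (fun f : {poly {mpoly F[r]}} => f`_(d + d')) E) _.
  apply: etrans (coef_mul_top (leq_trans (dg_le_msize _ _ _) hp)
    (leq_trans (dg_le_msize _ _ _) hq)) _.
  exact: (etrans (f_equal2 *%R tp tq) (esym (rmorphM infinity p q))).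
Qed.

Lemma meval_infinity p v : (infinity p).@[coord e ^~ v] = p.@[at_infinity e (T v)].
Proof.
apply: (eq_rmorph_mpoly (f := meval (coord e ^~ v) \o infinity)
  (g := meval (at_infinity e (T v)))) => [c|i] /=.
  by rewrite infinityC !mevalC.
case: (unliftP ord0 i) => [j ->|->]; rewrite mevalXU /at_infinity.
  by rewrite liftK infinityX; exact: (meval_lin he (coord e j \o T)).
by rewrite unlift_none infinityX0 meval0.
Qed.

Lemma vanishesP p : vanishes p <-> infinity p = 0.
Proof.
split=> [pv|p0 v vV]; last by rewrite -{1}(projv_id vV) -meval_infinity p0 meval0.
apply/eqP; apply: contraT => /mpoly_eval_neq0[a].
pose v := \sum_(i < r) a i *: e`_i.
rewrite (meval_eq _ (v2 := coord e ^~ v)) => [|i].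
  by rewrite meval_infinity pv ?memv_proj // eqxx.
by rewrite coord_sum_free // (basis_free he).
Qed.

Lemma exists_coord_neq0 v : v != 0 -> exists i, coord e i v != 0.
Proof.
move=> v0; apply/existsP; apply: contraNT v0 => /existsPn v0.
rewrite (basis_expand he v) big1 // => i _.
by have /negPn/eqP -> := v0 i; rewrite scale0r.
Qed.

(** Denominators correspond by [dehomogenize_homog]; in the other direction, numerator and
    denominator are both homogenized in the degree of the denominator. *)
Lemma proj_local_ringE :
  proj_local_ring (fun p => vanishes p) = local_ring e T.
Proof.
apply: same_pred_eq => x; split=> [[d [p [q [hp hq nq ->]]]]|[p [q [q0 pq dq ->]]]].
  have [mp _] := dehomogenize_homog hp; have [mq tq] := dehomogenize_homog hq.
  have q0 : infinity q != 0 by apply/eqP => q0; apply: nq; apply/vanishesP.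
  have dq : (d < dg e T (dehomogenize q))%N.
    by rewrite ltnNge; apply/negP => /leq_sizeP/(_ d (leqnn d)); rewrite tq; exact/eqP.
  have dqm := dg_le_msize e T (dehomogenize q).
  have dqE : dg e T (dehomogenize q) = msize (dehomogenize q).
    by apply/eqP; rewrite eqn_leq dqm (leq_trans mq).
  exists (dehomogenize p), (dehomogenize q); split.
  - by rewrite -(dg_gt0 he T) (leq_trans _ dq).
  - by apply: (leq_trans mp); rewrite -dqE.
  - exact: dqE.
  - exact: erefl.
case Ed : (msize q) => [|d] in pq dq *.
  by move: q0; rewrite -(mmeasure_poly_eq0 mdeg) Ed.
have [p' hp' pE] := homogenization pq.
have [|q' hq' qE] := homogenization (p := q) (d := d); first by rewrite Ed.
exists d, p', q'; split; [exact: hp' | exact: hq' | | by rewrite pE qE].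
move=> /vanishesP q'0; have [_] := dehomogenize_homog hq'; rewrite qE q'0 => /eqP.
by rewrite -[d]/(d.+1.-1) -dq -lead_coefE lead_coef_eq0 (phi_eq0 he) (negbTE q0).
Qed.

(** V is stable under scaling, so the polynomial c -> p (c v) has every scalar as a root and is
    zero. Its coefficients are the values at v of the homogeneous components. *)
Lemma vanishes_pihomog p d : vanishes p -> vanishes (pihomog mdeg d p).
Proof.
move=> pv v vV; pose w := at_infinity e v.
pose s : {rmorphism {mpoly F[r.+1]} -> {poly F}} :=
  subst (@polyC F) (fun i => (w i)%:P * 'X).
have sC c : s c%:MP = c%:P by exact: substC.
have sX i : s 'X_i = (w i)%:P * 'X by exact: substX.
have sE j q : q \is j.-homog for mdeg -> s q = (q.@[w])%:P * 'X^j.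
  apply: (homog_ind (Q := fun j q => s q = (q.@[w])%:P * 'X^j)) => {j q}.
  - by move=> j; rewrite rmorph0 meval0 mul0r.
  - by move=> c; rewrite sC mevalC mulr1.
  - by move=> i; rewrite sX mevalXU.
  - by move=> j a b sa sb; rewrite rmorphD /= sa sb mevalD polyCD mulrDl.
  - by move=> j j' a b sa sb; rewrite rmorphM /= sa sb mevalM polyCM exprD mulrACA.
have s0 : s p = 0.
  apply/eqP; apply: contraT => /(poly_horner_neq0 idfun)[c] /=.
  have -> : (s p).[c] = p.@[at_infinity e (c *: v)].
    apply: (eq_rmorph_mpoly (f := horner_eval c \o s)
      (g := meval (at_infinity e (c *: v)))) => [b|i] /=; rewrite horner_evalE.
      by rewrite sC hornerC mevalC.
    rewrite sX mevalXU hornerM hornerC hornerX /w /at_infinity.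
    by case: unlift => [j|]; rewrite ?mul0r // linearZ /= mulrC.
  by rewrite pv ?memvZ // eqxx.
pose k := maxn (msize p) d.+1.
have := congr1 (fun q : {poly F} => q`_d) s0.
rewrite coef0 {1}(@pihomog_partitionE _ _ mdeg k p) ?leq_maxl //.
rewrite rmorph_sum coef_sum /=.
under eq_bigr => i _ do rewrite (sE _ _ (pihomogP _ _ _)) coefCM coefXn.
have dk : (d < k)%N by rewrite leq_max leqnn orbT.
rewrite (bigD1 (Ordinal dk)) //= eqxx mulr1 big1 ?addr0 // => j.
by rewrite -val_eqE /= eq_sym => /negbTE ->; rewrite mulr0.
Qed.

(** The ideal is the kernel of [infinity], a morphism to a domain, hence prime; a nonzero vector of
    V keeps some variable out of it. *)
Lemma projective_completion_local_ring v : v \in V -> v != 0 ->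
  projective_completion (local_ring e T).
Proof.
move=> vV v0; exists (fun p => vanishes p); split; last by rewrite proj_local_ringE.
- split.
  + split=> [u _|p q hp hq u uV|p q hq u uV]; first exact: meval0.
      by rewrite mevalD hp // hq // addr0.
    by rewrite mevalM hq // mulr0.
  + by move=> /(_ v vV)/eqP; rewrite meval1 oner_eq0.
  + move=> p q /vanishesP; rewrite rmorphM => /eqP; rewrite mulf_eq0.
    by case/orP => /eqP h; [left | right]; exact/vanishesP.
  + by move=> p d; exact: vanishes_pihomog.
have [i vi] := exists_coord_neq0 v0.
exists (lift ord0 i) => /(_ v vV); rewrite mevalXU /at_infinity liftK => vi0.
by rewrite vi0 eqxx in vi.
Qed.

End Homogenization.

(** * Boundary divisors and global sections *)

Section WonderfulVariety.
Variables (R : realType) (L : vectType R[i]) (r n : nat) (e : r.-tuple L).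
Hypothesis he : basis_of {:L} e.
Variable (l : 'I_n -> 'Hom(L, (R[i])^o)).
Local Notation C := {mpoly R[i][r]}.
Local Notation "x %:F" := (@tofrac {mpoly R[i][r]} x).
Local Notation TF F := (projv (LF l F)).
Local Notation A F := (local_ring e (TF F)).
Local Notation VR F := (valuation_ring e (TF F)).
Local Notation deg F := (dg e (TF F)).
Implicit Types (F G : {set 'I_n}) (v : L).

Let TT F v : TF F (TF F v) = TF F v. Proof. exact: projv_proj. Qed.

Lemma stratumE F : stratum e l F = A F.
Proof. exact: (proj_local_ringE he (LF l F)). Qed.

Lemma mem_LF F v : (v \in LF l F) = [forall i in F, l i v == 0].
Proof.
rewrite memvE; apply/subv_bigcapP/forall_inP => h i iF; have := h i iF.
  by rewrite -memvE memv_ker.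
by rewrite -memvE memv_ker.
Qed.

Lemma flat_mem F j : flat l F -> (LF l F <= H l j)%VS = (j \in F).
Proof.
move=> /forallP fF; apply/idP/idP => [|jF]; first exact/implyP.
by apply: (bigcapv_inf j) => //; exact: subvv.
Qed.

(** If L_F were 0, every form would vanish on it and F would be everything. The coordinate i
    supplies the linear form that the blow-up lemmas require. *)
Lemma proper_flat_point F : proper_flat l F ->
  exists v i, [/\ v \in LF l F, v != 0 & coord e i (TF F v) != 0].
Proof.
case/andP=> fF FT.
have V0 : LF l F != 0%VS.
  apply: contra_neq FT => V0; apply/setP => j; rewrite inE -(flat_mem j fF) V0.
  exact: sub0v.
have vV := memv_pick (LF l F).
have v0 : vpick (LF l F) != 0 by rewrite vpick0.
have [i vi] := exists_coord_neq0 he v0.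
by exists (vpick (LF l F)), i; split=> //; rewrite projv_id.
Qed.

Lemma LF_separated F G : ~~ (LF l F <= LF l G)%VS ->
  exists2 j, j \in G & exists2 v, v \in LF l F & l j v != 0.
Proof.
move=> /subvPn[v vF]; rewrite mem_LF negb_forall_in => /exists_inP[j jG vj].
by exists j => //; exists v.
Qed.

Lemma dg_lin_hit F (f : {scalar L}) v : v \in LF l F -> f v != 0 ->
  deg F (lin e f) = 2%N.
Proof.
move=> vF fv; rewrite /dg (phi_lin he) size_line //.
by apply: (lin_neq0 he (v := v)); rewrite /= projv_id.
Qed.

Lemma dg_lin_miss F (f : {scalar L}) : (forall v, v \in LF l F -> f v = 0) ->
  (deg F (lin e f) <= 1)%N.
Proof.
move=> fF; rewrite /dg (phi_lin he) [lin e (f \o TF F)]big1 => [|j _].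
  by rewrite mul0r addr0 size_polyC_leq1.
by rewrite /= fF ?memv_proj // scale0r.
Qed.

(** Take a form l_j with j in G that is nonzero on L_F, and a coordinate x_i nonzero on L_G. The
    quotient x_i / l_j is regular at the generic point of P(L_F) but has a pole along P(L_G). *)
Lemma local_ring_not_contained F G : proper_flat l G ->
  ~~ (LF l F <= LF l G)%VS -> ~ contained (A F) (A G).
Proof.
move=> pG /LF_separated[j jG [v vF jv]] AFG.
have [w [i [wG w0 wi]]] := proper_flat_point pG.
rewrite projv_id // in wi.
pose f : {scalar L} := functional (l j); pose x := (lin e (coord e i))%:F / (lin e f)%:F.
have f0 : lin e f != 0 := lin_neq0 he (f := f) jv.
have h0 : lin e (coord e i) != 0 := lin_neq0 he wi.
have dF : deg F (lin e f) = 2%N := dg_lin_hit (f := f) vF jv.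
have mF : msize (lin e f) = 2%N.
  by apply/eqP; rewrite eqn_leq msize_lin -{1}dF dg_le_msize.
have /AFG /(local_ring_vge0 he) : A F x.
  by exists (lin e (coord e i)), (lin e f); rewrite mF; split=> //; exact: msize_lin.
have xf0 := mulf_neq0 (tofrac_neq0 h0) (invr_neq0 (tofrac_neq0 f0)).
rewrite (vgeE _ _ xf0) (fval_frac (dg_gt0 he (TF G)) (@dgM _ _ _ _ he (TF G)) h0 f0).
rewrite (dg_lin_hit wG wi).
have : (deg G (lin e f) <= 1)%N.
  by apply: dg_lin_miss => u; rewrite mem_LF => /forall_inP/(_ j jG)/eqP.
by move: (dg _ _ _) => d; clear; lia.
Qed.

(** A form l_j with j in F that is nonzero on L_G has degree 0 along L_F but degree 1 along L_G. *)
Lemma valuation_ring_not_contained F G :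
  ~~ (LF l G <= LF l F)%VS -> ~ contained (VR F) (A G).
Proof.
move=> /LF_separated[j jF [v vG jv]] VFG.
pose f : {scalar L} := functional (l j).
have f0 : lin e f != 0 := lin_neq0 he (f := f) jv.
have dg1 E : deg E 1 = 1%N by rewrite -mpolyC1 dgC // oner_neq0.
have /VFG /(local_ring_vge0 he) : VR F (lin e f)%:F.
  rewrite /valuation_ring (vgeE _ _ (tofrac_neq0 f0)).
  rewrite (fval_tofrac (dg_gt0 he (TF F)) (@dgM _ _ _ _ he (TF F)) f0) dg1.
  have : (deg F (lin e f) <= 1)%N.
    by apply: dg_lin_miss => u; rewrite mem_LF => /forall_inP/(_ j jF)/eqP.
  by move: (dg _ _ _) => d; clear; lia.
rewrite (vgeE _ _ (tofrac_neq0 f0)).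
rewrite (fval_tofrac (dg_gt0 he (TF G)) (@dgM _ _ _ _ he (TF G)) f0) dg1.
by rewrite (dg_lin_hit (f := f) vG jv).
Qed.

Lemma foldl_blowup_unaffected (B : {fraction C} -> Prop) (s : seq {set 'I_n}) X :
    B 1 -> (forall x y, B x -> B y -> B (x - y)) ->
    (forall x y, B x -> B y -> B (x * y)) ->
    (forall x y, nonunits B x -> nonunits B y -> nonunits B (x - y)) ->
    (forall G, G \in s -> ~ contained B (A G)) -> X B ->
  foldl (fun X F => blowup X (stratum e l F)) X s B.
Proof.
move=> B1 BB BM nB; elim: s X => //= G s IHs X sB XB.
apply: IHs => [G' G's|]; first by apply: sB; rewrite inE G's orbT.
apply: blowup_unaffected => //; rewrite stratumE; apply: sB.
by rewrite inE eqxx.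
Qed.

(* The generic point of P(L_F) avoids the centers before F, and the generic point
   of D_F avoids those after F. *)
Lemma boundary_divisor_valuation_ring F : proper_flat l F ->
  boundary_divisor e l F (VR F).
Proof.
move=> pF; have [v [i [vF v0 vi]]] := proper_flat_point pF.
have blowF := blowup_valuation_ring he (TT F) (f := coord e i) vi.
split; last by rewrite stratumE.
  have lA : {in blowup_order l, forall G, proper_flat l G}.
    by move=> G; rewrite mem_sort mem_enum inE.
  have FO : F \in blowup_order l by rewrite mem_sort mem_enum inE.
  have uO : uniq (blowup_order l) by rewrite sort_uniq enum_uniq.
  have sO : sorted (fun F G => (\dim (LF l F) <= \dim (LF l G))%N) (blowup_order l).
    by apply: sort_sorted => G G'; exact: leq_total.
  rewrite /wonderful; move: FO uO sO lA.
  move: (blowup_order l) => s sF; case/splitPr: sF => s1 s2 uO sO lA.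
  have neq G : G \in s1 ++ s2 -> G <> F.
    move=> Gs GF; move: uO; rewrite -cat1s uniq_catCA cat_uniq => /and3P[_ /hasPn+ _].
    by move=> /(_ G Gs); rewrite GF inE eqxx.
  (* A flat is determined by its subspace. So, with the ordering by dimension, L_F is in no earlier
     L_G and no later L_G is in L_F. *)
  have LF_inj G : G \in s1 ++ s2 -> LF l G <> LF l F.
    move=> Gs GF; apply: (neq G Gs); apply/setP => j.
    have /lA/andP[fG _] : G \in s1 ++ F :: s2.
      by move: Gs; rewrite !mem_cat inE => /orP[->|->]; rewrite ?orbT.
    by case/andP: pF => fF _; rewrite -(flat_mem j fG) -(flat_mem j fF) GF.
  have tr : transitive (fun F G => (\dim (LF l F) <= \dim (LF l G))%N).
    by move=> x y z; exact: leq_trans.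
  have before G : G \in s1 -> (\dim (LF l G) <= \dim (LF l F))%N.
    move=> Gs; move: sO; rewrite (sorted_pairwise tr) pairwise_cat => /and3P[+ _ _].
    by move=> /allrelP/(_ G F Gs); apply; rewrite inE eqxx.
  have after G : G \in s2 -> (\dim (LF l F) <= \dim (LF l G))%N.
    move=> Gs; move: sO; rewrite (sorted_pairwise tr) pairwise_cat => /and3P[_ _ /=].
    by move=> /andP[/allP/(_ G Gs)].
  rewrite foldl_cat /=; apply: foldl_blowup_unaffected.
  - by rewrite /valuation_ring (vgeE _ _ (oner_neq0 _))
      (fval1 (dg_gt0 he (TF F)) (@dgM _ _ _ _ he (TF F))).
  - move=> x y; exact: (vgeB (dg_gt0 he (TF F)) (@dgM _ _ _ _ he (TF F)) (dgB e (TF F))).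
  - move=> x y hx hy; rewrite /valuation_ring -(addr0 0).
    exact: (vgeM (dg_gt0 he (TF F)) (@dgM _ _ _ _ he (TF F)) hx hy).
  - move=> x y /(nonunits_valuation_ring he) hx /(nonunits_valuation_ring he) hy.
    apply/(nonunits_valuation_ring he).
    exact: (vgeB (dg_gt0 he (TF F)) (@dgM _ _ _ _ he (TF F)) (dgB e (TF F))).
  - move=> G Gs; apply: valuation_ring_not_contained; apply/negP => GF.
    apply: (LF_inj G); first by rewrite mem_cat Gs orbT.
    by apply/eqP; rewrite eqEdim GF after.
  exists (A F); last first.
    rewrite stratumE (_ : ideal_at (A F) (A F) = nonunits (A F)) //.
    apply: same_pred_eq => x; split=> [[_ h]|h]; first exact: h.
    by split=> //; case: h.
  apply: foldl_blowup_unaffected.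
  - exact: local_ring1.
  - exact: local_ringB.
  - exact: local_ringM.
  - move=> x y /(nonunits_local_ring he)[Ax vx] /(nonunits_local_ring he)[Ay vy].
    apply/(nonunits_local_ring he); split; first exact: local_ringB.
    exact: (vgeB (dg_gt0 he (TF F)) (@dgM _ _ _ _ he (TF F)) (dgB e (TF F))).
  - move=> G Gs; have Gs' : G \in s1 ++ s2 by rewrite mem_cat Gs.
    apply: local_ring_not_contained; first by apply: lA; rewrite mem_cat Gs.
    apply/negP => FG; apply: (LF_inj G Gs').
    by apply/esym/eqP; rewrite eqEdim FG before.
  exact: (projective_completion_local_ring he vF v0).
exists ((lin e (coord e i \o TF F))%:F^-1).
exact: (uniformizer_inv_y he (TT F) (f := coord e i) vi).
Qed.

(** Necessity evaluates the condition at the valuation ring, a genuine boundary divisor; sufficiency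
    uses that each boundary divisor computes the same order. The [+ 1] is again size against
    degree. *)
Lemma global_sectionP D (g : C) : g != 0 ->
  global_section e l D g <->
  (forall F, proper_flat l F -> (deg F g)%:Z <= D F + 1).
Proof.
move=> g0.
have vg F : fval (deg F) g%:F = 1 - (deg F g)%:Z.
  rewrite (fval_tofrac (dg_gt0 he (TF F)) (@dgM _ _ _ _ he (TF F)) g0).
  by rewrite -mpolyC1 dgC // oner_neq0.
split=> [hg F pF|hg F Y m pF].
  have [v [i [vF v0 vi]]] := proper_flat_point pF.
  have og := ord_valuation_ring he (TT F) (f := coord e i) vi (tofrac_neq0 g0).
  have := hg _ _ _ pF (boundary_divisor_valuation_ring pF) og.
  by rewrite vg; move: (dg _ _ _) => d; clear; lia.
have [v [i [vF v0 vi]]] := proper_flat_point pF.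
case=> _ _; rewrite stratumE => bY oY.
have -> : m = fval (deg F) g%:F := blowup_ord he (TT F) (f := coord e i) vi bY oY.
by rewrite vg; have := hg F pF; move: (dg _ _ _) => d; clear; lia.
Qed.

(** Zero has no order, being no unit times a power of a uniformizer, so the condition is vacuous. *)
Lemma global_section0 D : global_section e l D 0.
Proof.
move=> F Y m _ _ [t ut [u [u0 _ _]]]; rewrite tofrac0 => /esym/eqP.
by rewrite mulf_eq0 (negbTE u0) (negbTE (expfz_neq0 _ (uniformizer_neq0 ut))).
Qed.

End WonderfulVariety.

Theorem proposition1p3 (R : realType) (L : vectType R[i]) (r n : nat)
    (e : r.-tuple L) (he : basis_of {:L} e)
    (l : 'I_n -> 'Hom(L, (R[i])^o))
    (hl : (\bigcap_(i < n) lker (l i))%VS = 0%VS)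
    (k : int) (hk : k <= -1) :
  (forall g : {mpoly R[i][r]},
     global_section e l (div_LM l + div_alpha n *~ (k + 1)) g <->
     global_section e l (div_O1 n + div_alpha n *~ k) g) /\
  (forall g : {mpoly R[i][r]},
     C_space e l k g <->
     global_section e l (div_LM l + div_alpha n *~ (k + 1)) g).
Proof.
(* Three inclusions form a cycle: sections of L_M((k+1) alpha), sections of O(1,...,1)(k alpha),
   C_{L,k}, and back. The bound [k <= -1] enters in the last one. *)
have O1E F : (div_O1 n + div_alpha n *~ k) F = n%:Z - #|F|%:Z + k.
  by rewrite !ffunE ffunMzE ffunE intz.
have LME F : proper_flat l F -> [/\ (0 < \dim (LF l F))%N &
    (div_LM l + div_alpha n *~ (k + 1)) F
    = n%:Z - #|F|%:Z - (\dim (LF l F))%:Z + k + 1].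
  move=> pF; have [v [i [vF v0 _]]] := proper_flat_point he pF; split.
    by rewrite lt0n dimv_eq0; apply: contraNneq v0 => V0; move: vF; rewrite V0 memv0.
  rewrite !ffunE ffunMzE ffunE intz /rk.
  have := dimvS (subvf (LF l F)).
  by move: (\dim _) (\dim _) #|_| => a b c; clear; lia.
have LM_O1 g : global_section e l (div_LM l + div_alpha n *~ (k + 1)) g ->
    global_section e l (div_O1 n + div_alpha n *~ k) g.
  have [->|g0] := eqVneq g 0; first by move=> _; exact: global_section0.
  move=> /(global_sectionP he l _ g0) hg; apply/(global_sectionP he l _ g0) => F pF.
  have [dV E] := LME F pF; have := hg F pF; rewrite O1E E.
  by move: dV; move: (dg _ _ _) (\dim _) #|_| => a b c; clear; lia.
have O1_C g : global_section e l (div_O1 n + div_alpha n *~ k) g -> C_space e l k g.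
  have [->|g0] := eqVneq g 0; first by move=> _ f _; exact: diff_act0r.
  move=> /(global_sectionP he l _ g0) hg; apply/(C_spaceP e l k g0) => v v0.
  (* The forms vanishing at v make up a flat, proper because the H_i meet in 0, with v in L_F and
     rho v = n - |F|. The degree along v is at most that along L_F. *)
  pose F := [set i | v \in H l i].
  have vF : v \in LF l F.
    by rewrite mem_LF; apply/forall_inP => i; rewrite inE memv_ker.
  have pF : proper_flat l F.
    apply/andP; split.
      by apply/forallP => j; apply/implyP => /subvP/(_ v vF); rewrite inE.
    apply: contraNneq v0 => FT; rewrite -memv0 -hl memvE; apply/subv_bigcapP => i _.
    by have : i \in F by [rewrite FT inE]; rewrite inE memvE.
  have rhoE : (rho l v + #|F| = n)%N.
    rewrite -[RHS]card_ord -(cardsC F) addnC; congr (_ + _)%N.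
    by apply: eq_card => j; rewrite !inE.
  have := hg F pF; rewrite O1E.
  have := size_psi_le_phi he g (projv_id vF).
  rewrite -[size (phi _ _ _)]/(dg _ _ _); move: rhoE.
  by move: (size _) (dg _ _ _) (rho _ _) #|_| => a b c d; clear; lia.
have C_LM g : C_space e l k g ->
    global_section e l (div_LM l + div_alpha n *~ (k + 1)) g.
  have [->|g0] := eqVneq g 0; first by move=> _; exact: global_section0.
  move=> /(C_spaceP e l k g0) hg; apply/(global_sectionP he l _ g0) => F pF.
  have [dV ->] := LME F pF.
  have hv v : v \in LF l F -> v != 0 ->
      (size (psi e v g))%:Z <= #|[set i | l i v != 0]|%:Z + k + 1.
    move=> _ v0; have := hg v v0; rewrite /rho.
    by under eq_finset => i do rewrite memv_ker.
  (* The forms not vanishing on L_F number n - |F|, as F is a flat; so the bound is exactly the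
     coefficient of D_F plus one. *)
  have := degree_bound he hk (memv_proj (LF l F)) (@projv_id _ _ (LF l F)) dV g0 hv.
  have -> : [set i | ~~ (LF l F <= lker (l i))%VS] = ~: F.
    by case/andP: pF => fF _; apply/setP => j; rewrite !inE -(flat_mem j fF).
  have := cardsC F; rewrite card_ord -[size (phi _ _ _)]/(dg _ _ _).
  by move: (dg _ _ _) (\dim _) #|_| #|_| => a b c d; clear; lia.
split=> g; split=> [|h]; [exact: LM_O1 | exact/C_LM/O1_C | exact: C_LM |].
exact/O1_C/LM_O1.
Qed.
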